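(* Let $\Gamma=\mathbb{R}\times\{0,1\}\subset\mathbb{R}^2$ and let $\Lambda\subset\mathbb{R}^2$ be a set. Then $(\Gamma,\Lambda)$ is a Heisenberg uniqueness pair if and only if the set $$\pi_1^a(\Lambda)\cup\big(\pi_1^b(\Lambda)\setminus\pi_1^c(\Lambda)\big)$$ is dense in $\mathbb{R}$.
   Context: For a finite complex-valued Borel measure $\mu$ on $\mathbb{R}^2$, its Fourier transform is $\widehat\mu(\xi)=\int_{\mathbb{R}^2}\mathrm{e}^{\pi \mathrm{i}\langle x,\xi\rangle}\,\mathrm{d}\mu(x)$, where $\langle x,\xi\rangle=x_1\xi_1+x_2\xi_2$. For $f\in L^1(\mathbb{R})$, $\widehat f(t)=\int_{\mathbb{R}}\mathrm{e}^{\pi\mathrm{i}xt}f(x)\,\mathrm{d}x$. Let $\Gamma\subset\mathbb{R}^2$ be a smooth curve or a finite disjoint union of smooth curves, and let $\Lambda\subset\mathbb{R}^2$. The pair $(\Gamma,\Lambda)$ is called a Heisenberg uniqueness pair if every finite complex Borel measure $\mu$ on $\mathbb{R}^2$ with $\operatorname{supp}\mu\subset\Gamma$, which is absolutely continuous with respect to arc length measure on $\Gamma$ and satisfies $\widehat\mu(\xi)=0$ for all $\xi\in\Lambda$, is the zero measure. Let $\pi_1(\Lambda)\subset\mathbb{R}$ be the projection of $\Lambda$ to the first coordinate. It is split as a disjoint union $\pi_1(\Lambda)=\pi_1^a(\Lambda)\cup\pi_1^b(\Lambda)$: a point $t\in\pi_1(\Lambda)$ belongs to $\pi_1^a(\Lambda)$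 if there are two points $(t,\xi_2),(t,\eta_2)\in\Lambda$ with $\xi_2-\eta_2\notin 2\mathbb{Z}$, and belongs to $\pi_1^b(\Lambda)$ otherwise. For $t\in\pi_1^b(\Lambda)$, put $\chi(t)=\mathrm{e}^{\pi\mathrm{i}\xi_2}$, where $\xi_2$ is any real number with $(t,\xi_2)\in\Lambda$ (this is well defined). For a set $E\subset\mathbb{R}$, a point $t_0\in E$ and a function $\varphi:E\to\mathbb{C}$, one says that $\varphi$ is locally the Fourier transform of an $L^1(\mathbb{R})$ function around $t_0$ if there exist an open interval $I$ containing $t_0$ and a function $\psi=\widehat h$ with $h\in L^1(\mathbb{R})$ such that $\psi=\varphi$ on $E\cap I$. The set $\pi_1^c(\Lambda)$ consists of those $t_0\in\pi_1^b(\Lambda)$ such that $\chi:\pi_1^b(\Lambda)\to\mathbb{C}$ is locally the Fourier transform of an $L^1(\mathbb{R})$ function around $t_0$. *)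

(* Defs.v *)
From HB Require Import structures.
From mathcomp Require Import all_boot all_order all_algebra.
From mathcomp Require Import all_classical all_reals all_analysis.
From mathcomp Require Import complex.

Set Implicit Arguments.
Unset Strict Implicit.
Unset Printing Implicit Defensive.

Import Order.TTheory GRing.Theory Num.Theory.
Import numFieldNormedType.Exports.

Local Open Scope classical_set_scope.
Local Open Scope ring_scope.
Local Open Scope complex_scope.

Section complex_integral.
Context d (T : measurableType d) (R : realType).

Definition cintegrable (m : {measure set T -> \bar R}) (f : T -> R[i]) : Prop :=
  m.-integrable setT (EFin \o (fun x => complex.Re (f x))) /\
  m.-integrable setT (EFin \o (fun x => complex.Im (f x))).

Definition cintegral (m : {measure set T -> \bar R}) (f : T -> R[i]) : R[i] :=
  (\int[m]_x complex.Re (f x)) +i* (\int[m]_x complex.Im (f x)).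

Lemma Hahn_decomposition_pair (nu : {charge set T -> \bar R}) :
  exists PN : set T * set T, hahn_decomposition nu PN.1 PN.2.
Proof. by have [P [N PN]] := Hahn_decomposition nu; exists (P, N). Qed.

(* A Hahn decomposition is unique up to null sets (Hahn_decomposition_uniq), so
   the chosen one does not affect the Jordan decomposition on measurable sets. *)
Definition charge_pos (nu : {charge set T -> \bar R}) :
    {measure set T -> \bar R} :=
  jordan_pos (projT2 (cid (Hahn_decomposition_pair nu))).

Definition charge_neg (nu : {charge set T -> \bar R}) :
    {measure set T -> \bar R} :=
  jordan_neg (projT2 (cid (Hahn_decomposition_pair nu))).

Definition charge_integral (nu : {charge set T -> \bar R}) (f : T -> R[i]) :
    R[i] :=
  cintegral (charge_pos nu) f - cintegral (charge_neg nu) f.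

(* Charges are finite-valued in the library, so this is a finite complex
   measure, given by its real and imaginary parts. *)
Record complex_measure := ComplexMeasure {
  cm_re : {charge set T -> \bar R} ;
  cm_im : {charge set T -> \bar R} }.

Definition cm_eval (mu : complex_measure) (A : set T) : R[i] :=
  fine (cm_re mu A) +i* fine (cm_im mu A).

Definition cm_integral (mu : complex_measure) (f : T -> R[i]) : R[i] :=
  charge_integral (cm_re mu) f + (0 +i* 1) * charge_integral (cm_im mu) f.

End complex_integral.

Section fourier.
Context (R : realType).

(* e^(pi i x) *)
Definition expipi (x : R) : R[i] := cos (pi * x) +i* sin (pi * x).

Definition fourierL1 (h : R -> R[i]) (t : R) : R[i] :=
  cintegral lebesgue_measure (fun x => expipi (x * t) * h x).

Definition dot2 (x y : R * R) : R := x.1 * y.1 + x.2 * y.2.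

(* The canonical sigma-algebra on R * R is the product of the two Borel
   sigma-algebras, i.e. the Borel sigma-algebra of the plane. *)
Definition fourier_measure (mu : complex_measure (R * R)%type R) (xi : R * R) :
    R[i] :=
  cm_integral mu (fun x => expipi (dot2 x xi)).

(* x is in the support iff no open neighbourhood of x is null for |mu|, where
   |mu|(U) = 0 iff mu vanishes on every measurable subset of U. *)
Definition cm_support (mu : complex_measure (R * R)%type R) : set (R * R) :=
  [set x | forall U : set (R * R), open U -> U x ->
     exists A : set (R * R), [/\ measurable A, A `<=` U & cm_eval mu A != 0]].

End fourier.

Section curves.
Context (R : realType).

(* The domain may be any interval; a closed curve is parametrized by a
   half-open one, so that injectivity holds. *)
Record smooth_curve := SmoothCurve {
  cpath : R -> R * R ;
  cpath_dom : interval R ;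
  cpath_smooth1 : forall n (t : R), derivable (derive1n n (fst \o cpath)) t 1 ;
  cpath_smooth2 : forall n (t : R), derivable (derive1n n (snd \o cpath)) t 1 ;
  cpath_regular : forall t, t \in cpath_dom ->
    (derive1 (fst \o cpath) t, derive1 (snd \o cpath) t) != (0, 0) ;
  cpath_inj : {in cpath_dom &, injective cpath} }.

Definition curve_trace (c : smooth_curve) : set (R * R) :=
  cpath c @` [set` cpath_dom c].

Definition speed (c : smooth_curve) (t : R) : R :=
  Num.sqrt (derive1 (fst \o cpath c) t ^+ 2 + derive1 (snd \o cpath c) t ^+ 2).

Definition curve_length (c : smooth_curve) (A : set (R * R)) : \bar R :=
  (\int[lebesgue_measure]_(t in [set` cpath_dom c] `&` cpath c @^-1` A)
     (speed c t)%:E)%E.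

(* Gamma exhibited as a finite disjoint union of smooth curves. *)
Record smooth_curves (Gamma : set (R * R)) := SmoothCurves {
  ncurves : nat ;
  curves : 'I_ncurves -> smooth_curve ;
  curves_disjoint : trivIset setT (curve_trace \o curves) ;
  curves_cover : \bigcup_j curve_trace (curves j) = Gamma }.

Arguments curves [Gamma] s _.

Definition arc_length Gamma (G : smooth_curves Gamma) (A : set (R * R)) :
    \bar R :=
  (\sum_(j < ncurves G) curve_length (curves G j) A)%E.

Definition heisenberg_uniqueness_pair Gamma (G : smooth_curves Gamma)
    (Lambda : set (R * R)) : Prop :=
  forall mu : complex_measure (R * R)%type R,
    cm_support mu `<=` Gamma ->
    (forall A, measurable A -> arc_length G A = 0%E -> cm_eval mu A = 0) ->
    (forall xi, Lambda xi -> fourier_measure mu xi = 0) ->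
    forall A, measurable A -> cm_eval mu A = 0.

End curves.

Section horizontal_lines.
Context (R : realType).

Let line (c t : R) : R * R := (t, c).

Let derive1nS_cst n (a : R) : derive1n n.+1 (cst a : R -> R) = cst 0.
Proof.
elim: n => [|n IH]; first by apply/funext => x; rewrite derive1n1 derive1_cst.
by rewrite derive1nS IH; apply/funext => x; rewrite derive1_cst.
Qed.

Let cst_smooth c n (t : R) : derivable (derive1n n (snd \o line c)) t 1.
Proof.
have -> : snd \o line c = cst c by [].
by case: n => [|n]; rewrite ?derive1nS_cst; exact: derivable_cst.
Qed.

Let id_smooth c n (t : R) : derivable (derive1n n (fst \o line c)) t 1.
Proof.
have -> : fst \o line c = id by [].
case: n => [|n]; first exact: derivable_id.
have -> : derive1n n.+1 (id : R -> R) = derive1n n (cst 1 : R -> R).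
  rewrite /derive1n iterSr; congr (iter _ _ _).
  by apply/funext => x; rewrite derive1_id.
by case: n => [|n]; rewrite ?derive1nS_cst; exact: derivable_cst.
Qed.

Let line_regular c t : t \in (`]-oo, +oo[ : interval R) ->
  (derive1 (fst \o line c) t, derive1 (snd \o line c) t) != (0, 0).
Proof.
move=> _; have -> : fst \o line c = id by [].
by rewrite derive1_id xpair_eqE oner_eq0.
Qed.

Let line_inj c : {in (`]-oo, +oo[ : interval R) &, injective (line c)}.
Proof. by move=> s t _ _ []. Qed.

Definition horizontal_line (c : R) : smooth_curve R :=
  SmoothCurve (@id_smooth c) (@cst_smooth c) (@line_regular c) (@line_inj c).

Lemma curve_length_line (c : R) (A : set (R * R)) : measurable A ->
  curve_length (horizontal_line c) A = lebesgue_measure [set t | A (t, c)].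
Proof.
move=> mA; rewrite /curve_length.
have -> : [set` cpath_dom (horizontal_line c)] `&`
    cpath (horizontal_line c) @^-1` A = [set t | A (t, c)].
  by apply/seteqP; split => [t []//|t /= At]; split => //=; rewrite in_itv.
rewrite (@eq_integral _ _ _ _ _ (cst 1%E)); last first.
  move=> x _; rewrite /speed /=.
  have -> : fst \o line c = id by [].
  have -> : snd \o line c = cst c by [].
  by rewrite derive1_id derive1_cst expr1n expr0n addr0 sqrtr1.
rewrite integral_cst ?mul1e//.
by rewrite -[X in measurable X]setTI; apply: measurable_fun_pair.
Qed.

Let trace_line c : curve_trace (horizontal_line c) = setT `*` [set c].
Proof.
apply/seteqP; split => [_ [t _ <-]//|[t u] [_ /= ->]].
by exists t => //=; rewrite in_itv.
Qed.

Let lines_disjoint :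
  trivIset setT (curve_trace (R := R) \o fun j : 'I_2 => horizontal_line j%:R).
Proof.
move=> i j _ _ [x []]; rewrite /= !trace_line => -[_ /= ->] [_ /= /eqP].
by rewrite eqr_nat => /eqP /val_inj.
Qed.

Let lines_cover : \bigcup_(j : 'I_2) curve_trace (horizontal_line j%:R) =
  [set: R] `*` [set 0; 1].
Proof.
apply/seteqP; split => [[t u] [j _]|[t u] [_ /= [->|->]]].
- rewrite trace_line => -[_ /= ->]; split => //=.
  by case: j => -[|[|//]] ? /=; [left|right].
- by exists ord0 => //; rewrite trace_line.
- by exists ord_max => //; rewrite trace_line.
Qed.

(* R x {0, 1}, as the union of the curves t |-> (t, 0) and t |-> (t, 1). *)
Definition two_lines : smooth_curves ([set: R] `*` [set 0; 1]) :=
  SmoothCurves lines_disjoint lines_cover.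

End horizontal_lines.

Section projections.
Context (R : realType).
Implicit Type Lambda : set (R * R).

Definition pi1 Lambda : set R := fst @` Lambda.

Definition even_integers : set R := [set 2 * k%:~R | k in [set: int]].

Definition pi1a Lambda : set R :=
  [set t | exists xi2 eta2, [/\ Lambda (t, xi2), Lambda (t, eta2) &
                               ~ even_integers (xi2 - eta2)]].

Definition pi1b Lambda : set R := pi1 Lambda `\` pi1a Lambda.

(* Used on pi1b Lambda only, where it does not depend on the chosen ordinate:
   see chiE. *)
Definition chi Lambda (t : R) : R[i] := expipi (get [set xi2 | Lambda (t, xi2)]).

Lemma expipi_periodic (x : R) (k : int) : expipi (x + 2 * k%:~R) = expipi x.
Proof.
have H (n : nat) (y : R) : expipi (y + 2 * n%:R) = expipi y.
  rewrite /expipi mulrDr mulrA !mulr_natr.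
  by rewrite (periodicn (@cosD2pi R)) (periodicn (@sinD2pi R)).
case: k => n; first exact: H.
by rewrite NegzE mulrNz mulrN -(H n.+1) subrK.
Qed.

Lemma chiE Lambda t xi2 :
  pi1b Lambda t -> Lambda (t, xi2) -> chi Lambda t = expipi xi2.
Proof.
move=> [_ ta] txi; rewrite /chi; set eta2 := get _.
have teta : Lambda (t, eta2).
  by apply: (@getPex _ [set xi2 | Lambda (t, xi2)]); exists xi2.
have [k _ kE] : even_integers (eta2 - xi2).
  by apply: contrapT => h; apply: ta; exists eta2, xi2.
by rewrite -(subrK xi2 eta2) -kE addrC expipi_periodic.
Qed.

Definition locally_fourierL1 (E : set R) (phi : R -> R[i]) (t0 : R) : Prop :=
  exists (I : set R) (h : R -> R[i]),
    [/\ open I, is_interval I, I t0, cintegrable lebesgue_measure h &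
        forall t, (E `&` I) t -> fourierL1 h t = phi t].

Definition pi1c Lambda : set R :=
  [set t0 | pi1b Lambda t0 /\
            locally_fourierL1 (pi1b Lambda) (chi Lambda) t0].

End projections.

(* Main.v *)
(** A measure which is absolutely continuous on the two lines is a pair of
    integrable densities f, g, and its transform at (t, s) is
    f^(t) + e^(pi i s) g^(t).

    If this vanishes on Lambda, then f^ = g^ = 0 on pi1a, where two values of
    e^(pi i s) occur. On pi1b it reads f^ = - chi g^, and if g^(t0) <> 0 then
    Wiener's local division exhibits chi = - f^ / g^ as the transform of an L^1
    function near t0, so t0 is in pi1c. Hence f^ and g^ vanish on the set of
    the theorem; when it is dense they vanish identically, and f = g = 0.

    Conversely, if an interval misses this set, chi agrees with some h^ on
    pi1 Lambda near a point t0 of the interval; taking g <> 0 with g^ supported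
    close to t0 and f = - h * g gives a nonzero measure whose transform
    vanishes on Lambda. *)

From HB Require Import structures.
Require Import Defs.
From mathcomp Require Import all_boot all_order all_algebra.
From mathcomp Require Import all_classical all_reals all_analysis.
From mathcomp Require Import measurable_realfun complex.
From mathcomp Require Import ring lra.
Import Order.TTheory GRing.Theory Num.Theory.
Import numFieldNormedType.Exports.
Local Open Scope classical_set_scope.
Local Open Scope ring_scope.

Set Implicit Arguments.
Unset Strict Implicit.
Unset Printing Implicit Defensive.
Local Open Scope complex_scope.

(** * Complex-valued integrals *)

(** A single kernel drives the analysis: a difference of two Fejer kernels, whose transform is a
    trapezoid equal to 1 on one interval and 0 off a larger one. Pairing its translates with a
    function of zero transform and letting the slopes steepen gives injectivity of the transform.
    Dilated, it is a local unit for the division: near 0, g^ equals g^(0) plus the transform of a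
    function of small L^1 norm, so that dividing by g^ becomes a Neumann series of convolutions.
    Modulated, it is the g of the converse.

    Division also replaces continuity: g^ stays nonzero near a point where it is nonzero, because a
    trapezoid can be divided by it there.

    In the converse the measure must be shown to be nonzero, although f is known only through its
    transform. If the measure vanished, so would its transform on the whole vertical line over t0;
    the points (t0, 0) and (t0, 1) then give f^ + g^ = f^ - g^ = 0 at t0, against g^(t0) = 1. *)

Section complex_norm.
Context (R : rcfType).
Implicit Types z w : R[i].

(* Submultiplicative, like the modulus, but with no square root. *)
Definition cnorm1 z : R := `|complex.Re z| + `|complex.Im z|.

Lemma cnorm1_ge0 z : 0 <= cnorm1 z.
Proof. by rewrite addr_ge0. Qed.

Lemma cnorm1D z w : cnorm1 (z + w) <= cnorm1 z + cnorm1 w.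
Proof.
case: z w => a b [c d]; rewrite /cnorm1 /= addrACA.
by apply: lerD; exact: ler_normD.
Qed.

Lemma cnorm1N z : cnorm1 (- z) = cnorm1 z.
Proof. by case: z => a b; rewrite /cnorm1 /= !normrN. Qed.

Lemma cnorm1M z w : cnorm1 (z * w) <= cnorm1 z * cnorm1 w.
Proof.
case: z w => a b [c d]; rewrite /cnorm1 /=.
apply: (@le_trans _ _ (`|a * c| + `|b * d| + (`|a * d| + `|b * c|))).
  by apply: lerD; [exact: ler_normB|exact: ler_normD].
by rewrite !normrM; lra.
Qed.

Lemma cnorm1_0 : cnorm1 0 = 0. Proof. by rewrite /cnorm1 /= normr0 addr0. Qed.

Lemma cnorm1_eq0 z : cnorm1 z = 0 -> z = 0.
Proof.
case: z => a b; rewrite /cnorm1 /= => /eqP; rewrite paddr_eq0 //.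
by rewrite !normr_eq0 => /andP[/eqP-> /eqP->].
Qed.

Lemma cnorm1_Re z : `|complex.Re z| <= cnorm1 z. Proof. by rewrite lerDl. Qed.
Lemma cnorm1_Im z : `|complex.Im z| <= cnorm1 z. Proof. by rewrite lerDr. Qed.

Lemma cnorm1_real (x : R) : cnorm1 x%:C = `|x|.
Proof. by rewrite /cnorm1 /= normr0 addr0. Qed.

Lemma ReD z w : complex.Re (z + w) = complex.Re z + complex.Re w.
Proof. by case: z w => ? ? [? ?]. Qed.
Lemma ImD z w : complex.Im (z + w) = complex.Im z + complex.Im w.
Proof. by case: z w => ? ? [? ?]. Qed.
Lemma ReM z w : complex.Re (z * w) =
  complex.Re z * complex.Re w - complex.Im z * complex.Im w.
Proof. by case: z w => ? ? [? ?]. Qed.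
Lemma ImM z w : complex.Im (z * w) =
  complex.Re z * complex.Im w + complex.Im z * complex.Re w.
Proof. by case: z w => ? ? [? ?]. Qed.

End complex_norm.

Section complex_integral.
Context d (T : measurableType d) (R : realType).
Implicit Types (m : {measure set T -> \bar R}) (f g : T -> R[i]).

Definition cmeasurable f :=
  measurable_fun setT (fun x => complex.Re (f x)) /\
  measurable_fun setT (fun x => complex.Im (f x)).

(** Lies between the usual L^1 norm and [sqrt 2] times it, so finiteness and convergence to 0 mean
    the same for both. *)
Definition cL1norm m f : \bar R := (\int[m]_x (cnorm1 (f x))%:E)%E.

Lemma cmeasurableD f g :
  cmeasurable f -> cmeasurable g -> cmeasurable (fun x => f x + g x).
Proof.
move=> [mf nf] [mg ng]; split.
  by under eq_fun do rewrite ReD; exact: measurable_funD.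
by under eq_fun do rewrite ImD; exact: measurable_funD.
Qed.

Lemma cmeasurableM f g :
  cmeasurable f -> cmeasurable g -> cmeasurable (fun x => f x * g x).
Proof.
move=> [mf nf] [mg ng]; split.
  by under eq_fun do rewrite ReM; apply: measurable_funB; exact: measurable_funM.
by under eq_fun do rewrite ImM; apply: measurable_funD; exact: measurable_funM.
Qed.

Lemma cmeasurable_real (f : T -> R) :
  measurable_fun setT f -> cmeasurable (fun x => (f x)%:C).
Proof. by move=> mf; split => //=; exact: measurable_cst. Qed.

Lemma measurable_cnorm1 f :
  cmeasurable f -> measurable_fun setT (fun x => cnorm1 (f x)).
Proof.
by move=> [mf nf]; apply: measurable_funD; apply: measurableT_comp.
Qed.

Lemma measurable_cnorm1E f :
  cmeasurable f -> measurable_fun setT (fun x => (cnorm1 (f x))%:E).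
Proof. by move=> mf; apply/measurable_EFinP; exact: measurable_cnorm1. Qed.

Lemma cL1norm_ge0 m f : (0 <= cL1norm m f)%E.
Proof. by apply: integral_ge0 => x _; rewrite lee_fin cnorm1_ge0. Qed.

Lemma cintegrable_measurable m f : cintegrable m f -> cmeasurable f.
Proof.
by move=> [/integrableP[/measurable_EFinP ? _] /integrableP[/measurable_EFinP ? _]].
Qed.

Lemma cintegrableP m f :
  cintegrable m f <-> cmeasurable f /\ (cL1norm m f < +oo)%E.
Proof.
split=> [If|[mf lf]].
  have mf := cintegrable_measurable If; split => //.
  have [/integrableP h1 /integrableP h2] := If.
  case: h1 => _ h1; case: h2 => _ h2.
  rewrite /cL1norm; under eq_integral do rewrite EFinD.
  have [mr mi] := mf; rewrite ge0_integralD //; first exact: lte_add_pinfty.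
  - by apply/measurable_EFinP; exact: measurableT_comp.
  - by apply/measurable_EFinP; exact: measurableT_comp.
have mn := measurable_cnorm1E mf.
case: mf => mr mi; split; apply/integrableP; split.
- exact/measurable_EFinP.
- apply: le_lt_trans lf; apply: ge0_le_integral => //.
  + by apply/measurable_EFinP; apply: measurableT_comp.
  + by move=> x _; rewrite lee_fin cnorm1_Re.
- exact/measurable_EFinP.
- apply: le_lt_trans lf; apply: ge0_le_integral => //.
  + by apply/measurable_EFinP; apply: measurableT_comp.
  + by move=> x _; rewrite lee_fin cnorm1_Im.
Qed.

Lemma integrable_cnorm1 m f : cintegrable m f ->
  m.-integrable setT (EFin \o (fun x => cnorm1 (f x))).
Proof.
move=> /cintegrableP[mf lf]; apply/integrableP; split.
  exact: measurable_cnorm1E.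
by under eq_integral do rewrite /= ger0_norm ?cnorm1_ge0//.
Qed.

Lemma cintegrable_le m f (b : T -> R) : cmeasurable f ->
  m.-integrable setT (EFin \o b) -> (forall x, cnorm1 (f x) <= b x) ->
  cintegrable m f.
Proof.
move=> mf ib fb; apply/cintegrableP; split => //.
have /integrableP[mb lb] := ib.
apply: le_lt_trans lb; apply: ge0_le_integral => //.
- by move=> x _; rewrite lee_fin cnorm1_ge0.
- exact: measurable_cnorm1E.
- exact: measurableT_comp.
- by move=> x _; rewrite lee_fin (le_trans (fb x))// ler_norm.
Qed.

Lemma cintegrable0 m : cintegrable m (cst 0).
Proof. by split; exact: integrable0. Qed.

Lemma cintegrable_real m (f : T -> R) : m.-integrable setT (EFin \o f) ->
  cintegrable m (fun x => (f x)%:C).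
Proof. by move=> mf; split => //=; exact: integrable0. Qed.

Lemma cintegrableD m f g : cintegrable m f -> cintegrable m g ->
  cintegrable m (fun x => f x + g x).
Proof.
move=> [mf nf] [mg ng]; split.
  under eq_fun do rewrite ReD.
  by have := integrableD measurableT mf mg; apply: eq_integrable.
under eq_fun do rewrite ImD.
by have := integrableD measurableT nf ng; apply: eq_integrable.
Qed.

Lemma cintegrableM m f g (C : R) : cmeasurable f ->
  (forall x, cnorm1 (f x) <= C) -> cintegrable m g ->
  cintegrable m (fun x => f x * g x).
Proof.
move=> mf fC ig.
have := integrableZl measurableT C (integrable_cnorm1 ig).
move=> /(@eq_integrable _ _ _ _ _ measurableT _ (EFin \o (fun x => C * cnorm1 (g x)))).
move=> /(_ (fun x _ => erefl)) ib.
apply: (cintegrable_le _ ib).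
  by apply: cmeasurableM => //; exact: cintegrable_measurable ig.
move=> x; apply: (le_trans (cnorm1M _ _)).
by apply: ler_wpM2r => //; exact: cnorm1_ge0.
Qed.

Lemma cintegrableZ m z f : cintegrable m f -> cintegrable m (fun x => z * f x).
Proof.
move=> If; apply: (@cintegrableM m (cst z) f (cnorm1 z)) => //.
Qed.

Lemma cintegralD m f g : cintegrable m f -> cintegrable m g ->
  cintegral m (fun x => f x + g x) = cintegral m f + cintegral m g.
Proof.
move=> [mf nf] [mg ng]; rewrite /cintegral.
under eq_Rintegral do rewrite ReD.
under [X in _ +i* X]eq_Rintegral do rewrite ImD.
by rewrite !RintegralD.
Qed.

Lemma cintegralZ m z f : cintegrable m f ->
  cintegral m (fun x => z * f x) = z * cintegral m f.
Proof.
have iZ (a : R) (g : T -> R) : m.-integrable setT (EFin \o g) ->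
    m.-integrable setT (EFin \o (fun x => a * g x)).
  by move=> /(integrableZl measurableT a); apply: eq_integrable.
case: z => a b [mf nf]; rewrite /cintegral.
under eq_Rintegral do rewrite ReM /=.
under [X in _ +i* X]eq_Rintegral do rewrite ImM /=.
by rewrite RintegralB ?RintegralD// ?RintegralZl//; exact: iZ.
Qed.

Lemma eq_cintegral m f g : f =1 g -> cintegral m f = cintegral m g.
Proof. by move=> /funext ->. Qed.

Lemma cnorm1_cintegral m f : cmeasurable f ->
  ((cnorm1 (cintegral m f))%:E <= cL1norm m f)%E.
Proof.
move=> mf; have := leey (cL1norm m f).
rewrite le_eqVlt => /predU1P[->|lf]; first by rewrite leey.
have [rf nf] := (cintegrableP m f).2 (conj mf lf).
have inn (g : T -> R) : m.-integrable setT (EFin \o g) ->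
    m.-integrable setT (EFin \o (fun x => `|g x|)).
  by move=> /integrable_abse; apply: eq_integrable.
have <- : (\int[m]_x cnorm1 (f x))%:E = cL1norm m f.
  by rewrite fineK// ge0_fin_numE//; exact: cL1norm_ge0.
rewrite lee_fin RintegralD//; [|exact: inn..].
by apply: lerD; exact: le_normr_Rintegral.
Qed.

Lemma ae_eq_cintegral m f g : cmeasurable f -> cmeasurable g ->
  {ae m, forall x, f x = g x} -> cintegral m f = cintegral m g.
Proof.
move=> [mf nf] [mg ng] fg; rewrite /cintegral /Rintegral.
congr (_ +i* _); congr fine; apply: ae_eq_integral => //;
  try exact/measurable_EFinP.
  by apply: filterS fg => x -> _.
by apply: filterS fg => x -> _.
Qed.

End complex_integral.

(** * Iterated integrals of complex functions *)

Section fubini.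
Local Open Scope ereal_scope.
Context d1 d2 (T1 : measurableType d1) (T2 : measurableType d2) (R : realType).
Variables (m1 : {sigma_finite_measure set T1 -> \bar R}).
Variables (m2 : {sigma_finite_measure set T2 -> \bar R}).
Implicit Types (f : T1 * T2 -> R) (F : T1 * T2 -> R[i]).

(** Real integrals are nested through [fine], which sends an infinite inner integral to 0; this
    changes nothing when the inner integral is finite almost everywhere. *)
Let ae_fineK d (T : measurableType d) (m : {measure set T -> \bar R})
    (h : T -> \bar R) : measurable_fun setT h ->
  {ae m, forall x, h x \is a fin_num} ->
  \int[m]_x h x = \int[m]_x (fine (h x))%:E.
Proof.
move=> mh hfin; apply: ae_eq_integral => //.
  by apply/measurable_EFinP; exact: (measurableT_comp (fine_measurable measurableT)).
by apply: filterS hfin => x hx _; rewrite fineK.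
Qed.

Let abse_fine (x : \bar R) : `|(fine x)%:E| <= `|x|.
Proof. by case: x => [r| |] //=; rewrite normr0 leey. Qed.

Lemma integrable_Rintegral_prod f : (m1 \x m2).-integrable setT (EFin \o f) ->
  m1.-integrable setT (EFin \o (fun x => \int[m2]_y f (x, y))%R).
Proof.
move=> If; have IF := integrable_fubini_F If.
apply: (le_integrable measurableT _ _ IF).
  apply/measurable_EFinP.
  exact: (measurableT_comp (fine_measurable measurableT) (measurable_fubini_F If)).
by move=> x _; exact: abse_fine.
Qed.

Lemma Rintegral_fubini f : (m1 \x m2).-integrable setT (EFin \o f) ->
  (\int[m1]_x \int[m2]_y f (x, y) = \int[m2]_y \int[m1]_x f (x, y))%R.
Proof.
move=> If; rewrite /Rintegral; congr fine.
have h1 := ae_fineK (measurable_fubini_F If).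
have h2 := ae_fineK (measurable_fubini_G If).
rewrite /fubini_F /fubini_G /= in h1 h2.
rewrite -h1; last first.
  have := integrable_ae measurableT (integrable_fubini_F If).
  by apply: filterS => x /(_ I).
rewrite -h2; last first.
  have := ae_integrable2 If.
  by apply: filterS => x /(integrable_fin_num measurableT).
exact: (Fubini If).
Qed.

Lemma cintegrable_prod F : cintegrable (m1 \x m2) F ->
  cintegrable m1 (fun x => cintegral m2 (fun y => F (x, y))).
Proof.
move=> [rF iF]; split; first exact: (integrable_Rintegral_prod rF).
exact: (integrable_Rintegral_prod iF).
Qed.

Lemma cintegral_fubini F : cintegrable (m1 \x m2) F ->
  cintegral m1 (fun x => cintegral m2 (fun y => F (x, y))) =
  cintegral m2 (fun y => cintegral m1 (fun x => F (x, y))).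
Proof.
move=> [rF iF]; rewrite /cintegral /=; congr (_ +i* _)%C.
  exact: Rintegral_fubini rF.
exact: Rintegral_fubini iF.
Qed.

Lemma cmeasurable_section F x : cmeasurable F ->
  cmeasurable (fun y => F (x, y)).
Proof.
move=> [rF iF]; split.
  exact: (measurableT_comp rF (pair1_measurable x)).
exact: (measurableT_comp iF (pair1_measurable x)).
Qed.

Lemma cintegrable_prod_lty F : cmeasurable F ->
  \int[m2]_y cL1norm m1 (fun x => F (x, y)) < +oo -> cintegrable (m1 \x m2) F.
Proof.
move=> mF Foo; apply/cintegrableP; split => //.
rewrite /cL1norm (fubini_tonelli2 (fun z => (cnorm1 (F z))%:E))//.
  exact: measurable_cnorm1E.
by move=> z; rewrite lee_fin cnorm1_ge0.
Qed.

(** Minkowski's integral inequality for exponent 1: the norm passes under the inner integral, then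
    Tonelli exchanges the order. *)
Lemma cL1norm_prod F : cintegrable (m1 \x m2) F ->
  cL1norm m1 (fun x => cintegral m2 (fun y => F (x, y))) <=
  \int[m2]_y cL1norm m1 (fun x => F (x, y)).
Proof.
move=> IF; have mF := cintegrable_measurable IF.
have F0 z : 0 <= (cnorm1 (F z))%:E by rewrite lee_fin cnorm1_ge0.
have mN := measurable_cnorm1E mF.
rewrite -(fubini_tonelli (fun z => (cnorm1 (F z))%:E))//.
apply: ge0_le_integral => //.
- by move=> x _; rewrite lee_fin cnorm1_ge0.
- by apply: measurable_cnorm1E; exact: cintegrable_measurable (cintegrable_prod IF).
- exact: (measurable_fun_fubini_tonelli_F (fun z => (cnorm1 (F z))%:E)).
- by move=> x _; apply: cnorm1_cintegral; exact: cmeasurable_section.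
Qed.

End fubini.

(** * Image measures *)

Section push_measure.
Local Open Scope ereal_scope.
Context d d' (T1 : measurableType d) (T2 : measurableType d') (R : realType).
Variables (m : {measure set T1 -> \bar R}) (f : T1 -> T2).
Hypothesis mf : measurable_fun setT f.

Definition push_measure : {measure set T2 -> \bar R} :=
  measure_function_pushforward__canonical__measure_function_Measure m mf.

Lemma ge0_integral_push_measure (g : T2 -> \bar R) :
  measurable_fun setT g -> (forall y, 0 <= g y) ->
  \int[push_measure]_y g y = \int[m]_x g (f x).
Proof. by move=> mg g0; exact: (ge0_integral_pushforward mf m). Qed.

Lemma integral_push_measure (g : T2 -> \bar R) :
  measurable_fun setT g -> m.-integrable setT (g \o f) ->
  \int[push_measure]_y g y = \int[m]_x g (f x).
Proof. by move=> mg ig; exact: (integral_pushforward mf mg). Qed.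

Lemma integrable_push_measure (g : T2 -> \bar R) :
  measurable_fun setT g -> m.-integrable setT (g \o f) ->
  push_measure.-integrable setT g.
Proof. by move=> mg ig; exact: (integrable_pushforward mf mg). Qed.

End push_measure.

(** * Fourier transform and convolution *)

Section affine_change.
Context (R : realType).
Local Notation mu := (@lebesgue_measure R).
Local Open Scope ereal_scope.

Let affine (a b x : R) : R := (a * x + b)%R.

Let measurable_affine a b : measurable_fun setT (affine a b).
Proof.
apply: continuous_measurable_fun => x; apply: cvgD; last exact: cvg_cst.
by apply: cvgM; [exact: cvg_cst|exact: cvg_id].
Qed.

Let affine_push a b : {measure set (measurableTypeR R) -> \bar R} :=
  @push_measure _ _ (measurableTypeR R) (measurableTypeR R) R mu _
    (measurable_affine a b).

(** The right-hand side is a measure in [A] that agrees with [mu] on half-open intervals, and these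
    determine Lebesgue measure. *)
Lemma lebesgue_measure_affine (a b : R) (A : set R) : a != 0%R -> measurable A ->
  mu A = `|a|%:E * mu ((fun x => a * x + b)%R @^-1` A).
Proof.
move=> a0 mA.
pose k : {nonneg R} := NngNum (normr_ge0 a).
pose m' : {measure set (measurableTypeR R) -> \bar R} :=
  mscale k (affine_push a b).
suff : forall A, measurable A -> mu A = m' A by move/(_ _ mA).
apply: lebesgue_measure_unique => X /ocitvP[->|[[u v] /= uv ->]].
  by rewrite !measure0.
rewrite -[RHS]/(`|a|%:E * mu (affine a b @^-1` `]u, v]%classic)).
rewrite lebesgue_measure_itv /= lte_fin uv.
have [ap|an|a00] := ltgtP a 0%R; last by rewrite a00 eqxx in a0.
(* A negative slope reverses the interval, so the preimage is closed on the left instead; its length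
   is still [(v - u) / |a|]. *)
- have -> : affine a b @^-1` `]u, v]%classic = `[((v - b) / a)%R, ((u - b) / a)%R[%classic.
    apply/seteqP; split => x; rewrite /= !in_itv /= /affine.
      by rewrite ler_ndivrMr// ltr_ndivlMr// => /andP[? ?]; apply/andP; split; lra.
    by rewrite ler_ndivrMr// ltr_ndivlMr// => /andP[? ?]; apply/andP; split; lra.
  rewrite lebesgue_measure_itv /= lte_fin ltr_ndivlMr// divfK// ltrD2r uv.
  by rewrite -!EFinB -EFinM; congr EFin; rewrite ltr0_norm//; field.
- have -> : affine a b @^-1` `]u, v]%classic = `]((u - b) / a)%R, ((v - b) / a)%R]%classic.
    apply/seteqP; split => x; rewrite /= !in_itv /= /affine.
      by rewrite ltr_pdivrMr// ler_pdivlMr// => /andP[? ?]; apply/andP; split; lra.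
    by rewrite ltr_pdivrMr// ler_pdivlMr// => /andP[? ?]; apply/andP; split; lra.
  rewrite lebesgue_measure_itv /= lte_fin ltr_pdivrMr// divfK// ltrD2r uv.
  by rewrite -!EFinB -EFinM; congr EFin; rewrite gtr0_norm//; field.
Qed.

Lemma ge0_integral_affine (a b : R) (f : R -> \bar R) : a != 0%R ->
  measurable_fun setT f -> (forall x, 0 <= f x) ->
  \int[mu]_x f x = `|a|%:E * \int[mu]_x f (a * x + b)%R.
Proof.
move=> a0 mf f0.
pose k : {nonneg R} := NngNum (normr_ge0 a).
rewrite (eq_measure_integral (mscale k (affine_push a b))).
  by rewrite ge0_integral_mscale// ge0_integral_push_measure.
by move=> A mA _; exact: lebesgue_measure_affine.
Qed.

Lemma integrable_affine (a b : R) (f : R -> R) : a != 0%R ->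
  mu.-integrable setT (EFin \o f) ->
  mu.-integrable setT (EFin \o (fun x => f (a * x + b)%R)).
Proof.
move=> a0 /integrableP[mf lf]; apply/integrableP; split.
  exact: (measurableT_comp mf (measurable_affine a b)).
move: lf; rewrite (@ge0_integral_affine a b)//; last exact: measurableT_comp.
set I := (X in _ * X < _) => lf; rewrite -[X in X < _]/I.
have : 0 <= I by exact: integral_ge0.
have na : (0 < `|a|)%R by rewrite normr_gt0.
by case: I lf => [r _ _|+ _|]//; [exact: ltry|rewrite gt0_muley ?lte_fin].
Qed.

Lemma Rintegral_affine (a b : R) (f : R -> R) : a != 0%R ->
  mu.-integrable setT (EFin \o f) ->
  (\int[mu]_x f (a * x + b) = `|a|^-1 * \int[mu]_x f x)%R.
Proof.
move=> a0 If; have Ig := integrable_affine b a0 If.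
have na : (`|a| != 0)%R by rewrite normr_eq0.
apply: (mulfI na); rewrite mulrA divff// mul1r /Rintegral.
rewrite -[X in (X * _)%R]/(fine `|a|%:E) -fineM//; last exact: integrable_fin_num.
congr fine; have mf := measurable_int _ If.
rewrite !(integralE _ _ (fun=> EFin _)) muleBr//; last first.
  by apply: fin_num_adde_defr; exact: (integrable_pos_fin_num measurableT Ig).
congr (_ - _).
  by rewrite [RHS](@ge0_integral_affine a b) => //;
    [congr (_ * _); apply: eq_integral => x _; rewrite !funeposE|exact: measurable_funepos].
by rewrite [RHS](@ge0_integral_affine a b) => //;
    [congr (_ * _); apply: eq_integral => x _; rewrite !funenegE|exact: measurable_funeneg].
Qed.

Lemma cintegral_affine (a b : R) (f : R -> R[i]) : a != 0%R ->
  cintegrable mu f ->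
  (cintegral mu (fun x => f (a * x + b)) = (`|a|^-1)%:C * cintegral mu f)%R.
Proof.
move=> a0 [rf jf]; rewrite /cintegral.
rewrite (Rintegral_affine b a0 rf) (Rintegral_affine b a0 jf).
by apply/eqP; rewrite eq_complex ReM ImM /= !mul0r subr0 addr0 !eqxx.
Qed.

Lemma cintegrable_affine (a b : R) (f : R -> R[i]) : a != 0%R ->
  cintegrable mu f -> cintegrable mu (fun x => f (a * x + b)%R).
Proof.
move=> a0 [rf jf].
by split; [exact: (integrable_affine b a0 rf)|exact: (integrable_affine b a0 jf)].
Qed.

End affine_change.

Section fourier_transform.
Context (R : realType).
Local Notation mu := (@lebesgue_measure R).
Implicit Types (f g h : R -> R[i]) (t x y : R).

Lemma expipiD x y : expipi (x + y) = expipi x * expipi y.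
Proof.
rewrite /expipi mulrDr cosD sinD; apply/eqP.
by rewrite eq_complex ReM ImM /= eqxx /= addrC [sin _ * _]mulrC.
Qed.

Lemma expipi0 : expipi (0 : R) = 1.
Proof. by rewrite /expipi mulr0 cos0 sin0. Qed.

Lemma expipiNK x : expipi x * expipi (- x) = 1.
Proof. by rewrite -expipiD subrr expipi0. Qed.

(** The sharp bound is [sqrt 2]; the cruder 2 is the constant that recurs in the later
    dominations. *)
Lemma cnorm1_expipi x : cnorm1 (expipi x) <= 2.
Proof. 
rewrite /cnorm1 /= (_ : 2 = 1 + 1) // lerD// ler_norml.
  by rewrite cos_geN1 cos_le1.
by rewrite sin_geN1 sin_le1.
Qed.

Lemma cmeasurable_expipi d (T : measurableType d) (phi : T -> R) :
  measurable_fun setT phi -> cmeasurable (fun u => expipi (phi u)).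
Proof.
move=> mphi.
have mpi : measurable_fun setT (fun u => pi * phi u).
  exact: (measurable_funM (measurable_cst _) mphi).
split.
  apply: (measurableT_comp (f := cos) _ mpi).
  exact: continuous_measurable_fun (@continuous_cos R).
apply: (measurableT_comp (f := sin) _ mpi).
exact: continuous_measurable_fun (@continuous_sin R).
Qed.

Lemma cmeasurable_expipi_mulr t : cmeasurable (fun x : R => expipi (x * t)).
Proof. by apply: cmeasurable_expipi; exact: mulrr_measurable. Qed.

Lemma cintegrable_fourier h t : cintegrable mu h ->
  cintegrable mu (fun x => expipi (x * t) * h x).
Proof.
apply: (cintegrableM (C := 2)); first exact: cmeasurable_expipi_mulr.
by move=> x; exact: cnorm1_expipi.
Qed.

Lemma fourierL1_shift h y t : cintegrable mu h ->
  fourierL1 (fun x => h (x - y)) t = expipi (y * t) * fourierL1 h t.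
Proof.
move=> ih.
have := cintegral_affine (- y) (oner_neq0 R) (cintegrable_fourier t ih).
rewrite normr1 invr1 mul1r -/(fourierL1 h t) => <-.
rewrite -cintegralZ; last first.
  exact: (cintegrable_affine (- y) (oner_neq0 R) (cintegrable_fourier t ih)).
apply: eq_cintegral => x; rewrite mul1r mulrA -expipiD; congr (expipi _ * _).
by ring.
Qed.

Lemma fourierL1_modulation h s t :
  fourierL1 (fun x => expipi (x * s) * h x) t = fourierL1 h (t + s).
Proof.
by apply: eq_cintegral => x; rewrite mulrA -expipiD mulrDr.
Qed.

Lemma fourierL1Z z h t : cintegrable mu h ->
  fourierL1 (fun x => z * h x) t = z * fourierL1 h t.
Proof.
move=> ih; rewrite -cintegralZ; last exact: cintegrable_fourier.
by apply: eq_cintegral => x; rewrite mulrCA.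
Qed.

Lemma fourierL1D f g t : cintegrable mu f -> cintegrable mu g ->
  fourierL1 (fun x => f x + g x) t = fourierL1 f t + fourierL1 g t.
Proof.
move=> fi gi; rewrite -cintegralD; [|exact: cintegrable_fourier..].
by apply: eq_cintegral => x; rewrite mulrDr.
Qed.

Lemma cnorm1_fourierL1 h t : cintegrable mu h ->
  ((cnorm1 (fourierL1 h t))%:E <= 2%:E * cL1norm mu h)%E.
Proof.
move=> ih; have iF := cintegrable_fourier t ih.
have mh := measurable_cnorm1E (cintegrable_measurable ih).
apply: (le_trans (cnorm1_cintegral mu (cintegrable_measurable iF))).
rewrite /cL1norm -ge0_integralZl//; last first.
  by move=> x _; rewrite lee_fin cnorm1_ge0.
apply: ge0_le_integral => //.
- by move=> x _; rewrite lee_fin cnorm1_ge0.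
- exact: measurable_cnorm1E (cintegrable_measurable iF).
- exact: measurable_funeM.
- move=> x _; rewrite -EFinM lee_fin (le_trans (cnorm1M _ _))//.
  by rewrite ler_wpM2r ?cnorm1_ge0// cnorm1_expipi.
Qed.

End fourier_transform.

(** * Superpositions of kernels and convolution *)

Section kernel_superposition.
Context (R : realType).
Local Notation mu := (@lebesgue_measure R).
Implicit Types (f g h : R -> R[i]) (A : R * R -> R[i]).

Lemma ae_cintegrable_section A : cintegrable (mu \x mu)%E A ->
  {ae mu, forall x, cintegrable mu (fun y => A (x, y))}.
Proof.
by move=> [/ae_integrable1 rA /ae_integrable1 iA]; apply: filterS2 rA iA.
Qed.

Lemma fourierL1_superposition A t : cintegrable (mu \x mu)%E A ->
  fourierL1 (fun x => cintegral mu (fun y => A (x, y))) t =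
  cintegral mu (fun y => fourierL1 (fun x => A (x, y)) t).
Proof.
move=> IA.
have IE : cintegrable (mu \x mu)%E (fun z => expipi (z.1 * t) * A z).
  apply: (cintegrableM (C := 2)) => //; last by move=> z; exact: cnorm1_expipi.
  apply: cmeasurable_expipi.
  exact: (measurable_funM measurable_fst (measurable_cst t)).
rewrite -(cintegral_fubini IE) /fourierL1.
(* Equality holds almost everywhere only: for a null set of [x] the section of [A] may fail to be
   integrable, and then the scalar cannot be moved out of the integral. *)
apply: ae_eq_cintegral.
- apply: cmeasurableM; first exact: cmeasurable_expipi_mulr.
  exact: cintegrable_measurable (cintegrable_prod IA).
- exact: cintegrable_measurable (cintegrable_prod IE).
- have := ae_cintegrable_section IA.
  apply: (filterS (Filter := ae_filter_ringOfSetsType mu)) => x Ix.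
  by rewrite -(cintegralZ _ Ix).
Qed.

Lemma measurable_cL1norm_section A : cmeasurable A ->
  measurable_fun setT (fun y => cL1norm mu (fun x => A (x, y))).
Proof.
move=> mA.
have A0 z : (0 <= (cnorm1 (A z))%:E)%E by rewrite lee_fin cnorm1_ge0.
exact: (measurable_fun_fubini_tonelli_G (m1 := mu) _ (measurable_cnorm1E mA) A0).
Qed.

(** A uniform bound on the columns [A (_, y)] makes [A] an operator on L^1 that commutes with the
    transform. It is applied to translates of a function (convolution), to modulations of a kernel
    (uniqueness) and to differences of translates (local division). The norm bound keeps each column
    norm under the integral, so that dominated convergence can be applied to it. *)
Lemma kernel_superposition A g (C : R) : cmeasurable A ->
  (forall y, (cL1norm mu (fun x => A (x, y)) <= C%:E)%E) -> cintegrable mu g ->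
  let h x := cintegral mu (fun y => A (x, y) * g y) in
  [/\ cintegrable mu h,
    forall t, fourierL1 h t =
      cintegral mu (fun y => fourierL1 (fun x => A (x, y)) t * g y) &
    (cL1norm mu h <=
      \int[mu]_y (cL1norm mu (fun x => A (x, y)) * (cnorm1 (g y))%:E))%E].
Proof.
move=> mA AC Ig h.
have IA y : cintegrable mu (fun x => A (x, y)).
  apply/cintegrableP; split; last exact: le_lt_trans (AC y) (ltry _).
  case: mA => mr mi; split.
    exact: (measurableT_comp mr (pair2_measurable y)).
  exact: (measurableT_comp mi (pair2_measurable y)).
pose K (z : R * R) := A z * g z.2.
have [mgr mgi] := cintegrable_measurable Ig.
have mK : cmeasurable K.
  apply: cmeasurableM => //; split.
    exact: (measurableT_comp mgr measurable_snd).
  exact: (measurableT_comp mgi measurable_snd).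
have AK y : (cL1norm mu (fun x => K (x, y)) <=
    cL1norm mu (fun x => A (x, y)) * (cnorm1 (g y))%:E)%E.
  rewrite muleC /cL1norm -ge0_integralZl//; last 3 first.
  - exact: measurable_cnorm1E (cintegrable_measurable (IA y)).
  - by move=> x _; rewrite lee_fin cnorm1_ge0.
  - by rewrite lee_fin cnorm1_ge0.
  have IKy : cintegrable mu (fun x => A (x, y) * g y).
    under eq_fun do rewrite mulrC; exact: cintegrableZ.
  apply: ge0_le_integral => //.
  - by move=> x _; rewrite lee_fin cnorm1_ge0.
  - exact: measurable_cnorm1E (cintegrable_measurable IKy).
  - apply: measurable_funeM.
    exact: measurable_cnorm1E (cintegrable_measurable (IA y)).
  - by move=> x _; rewrite -EFinM lee_fin mulrC cnorm1M.
have mN := measurable_cL1norm_section.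
have KA : (\int[mu]_y cL1norm mu (fun x => K (x, y)) <=
   \int[mu]_y (cL1norm mu (fun x => A (x, y)) * (cnorm1 (g y))%:E))%E.
  apply: ge0_le_integral => //.
  - by move=> y _; exact: cL1norm_ge0.
  - exact: mN.
  - apply: emeasurable_funM; first exact: mN.
    exact: measurable_cnorm1E.
have IK : cintegrable (mu \x mu)%E K.
  apply: cintegrable_prod_lty => //; apply: (le_lt_trans KA).
  apply: (@le_lt_trans _ _ (\int[mu]_y (C%:E * (cnorm1 (g y))%:E))%E).
    apply: ge0_le_integral => //.
    - by move=> y _; rewrite mule_ge0 ?cL1norm_ge0// lee_fin cnorm1_ge0.
    - apply: emeasurable_funM; first exact: mN.
      exact: measurable_cnorm1E.
    - by apply: measurable_funeM; exact: measurable_cnorm1E.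
    - by move=> y _; rewrite lee_wpmul2r// lee_fin cnorm1_ge0.
  have := integrable_lty measurableT
    (integrableZl measurableT C (integrable_cnorm1 Ig)).
  exact.
split.
- exact: cintegrable_prod IK.
- move=> t; rewrite -[LHS]/(fourierL1 (fun x => cintegral mu (fun y => K (x, y))) t).
  rewrite fourierL1_superposition//; apply: eq_cintegral => y.
  rewrite /K /= mulrC -fourierL1Z//; congr fourierL1; apply/funext => x.
  by rewrite mulrC.
- exact: le_trans (cL1norm_prod IK) KA.
Qed.

Lemma cL1norm_shift f y : cmeasurable f ->
  cL1norm mu (fun x => f (x - y)) = cL1norm mu f.
Proof.
move=> mf; rewrite /cL1norm.
rewrite [RHS](@ge0_integral_affine _ 1 (- y)) ?oner_neq0//.
- rewrite normr1 mul1e; apply: eq_integral => x _; by rewrite mul1r.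
- exact: measurable_cnorm1E.
- by move=> x; rewrite lee_fin cnorm1_ge0.
Qed.

(** The superposition of the translates [f (x - y)] with weights [g y]. The function itself stays
    hidden, since later only its transform and its norm are used. *)
Lemma convolution_exists f g : cintegrable mu f -> cintegrable mu g ->
  exists h, [/\ cintegrable mu h,
    forall t, fourierL1 h t = fourierL1 f t * fourierL1 g t &
    (cL1norm mu h <= cL1norm mu f * cL1norm mu g)%E].
Proof.
move=> If Ig; have [mfr mfi] := cintegrable_measurable If.
have [_ lf] := (cintegrableP mu f).1 If; have [mg lg] := (cintegrableP mu g).1 Ig.
pose A (z : R * R) := f (z.1 - z.2).
have mB : measurable_fun setT (fun z : R * R => z.1 - z.2).
  exact: (measurable_funB measurable_fst measurable_snd).
have NA y : cL1norm mu (fun x => A (x, y)) = cL1norm mu f by exact: cL1norm_shift.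
have NE : (\int[mu]_y (cL1norm mu (fun x => A (x, y)) * (cnorm1 (g y))%:E) =
    cL1norm mu f * cL1norm mu g)%E.
  under eq_integral do rewrite NA.
  rewrite ge0_integralZl//; first exact: measurable_cnorm1E.
  - by move=> y _; rewrite lee_fin cnorm1_ge0.
  - exact: cL1norm_ge0.
have [||Ih Fh Nh] := @kernel_superposition A g (fine (cL1norm mu f)) _ _ Ig.
- by split; [exact: (measurableT_comp mfr mB)|exact: (measurableT_comp mfi mB)].
- by move=> y; rewrite NA fineK// ge0_fin_numE// cL1norm_ge0.
eexists; split; [exact: Ih| |by rewrite -NE].
move=> t; rewrite Fh -cintegralZ; last exact: cintegrable_fourier.
by apply: eq_cintegral => y; rewrite fourierL1_shift// mulrAC mulrC mulrA.
Qed.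

End kernel_superposition.

(** * Fejer kernels and uniqueness *)

Section fejer.
Context (R : realType).
Local Notation mu := (@lebesgue_measure R).
Implicit Types (p q s t x : R).

(** By the convention [0^-1 = 0] the inverse is defined at 0 but discontinuous there; that point is
    split off. *)
Lemma measurable_invr : measurable_fun setT (fun x : R => x^-1).
Proof.
rewrite -(setUv [set 0 : R]); apply/measurable_funU => //; first exact: measurableC.
split; first exact: measurable_fun_set1.
apply: open_continuous_measurable_fun.
  by apply: closed_openC; exact: closed_eq.
by move=> x /set_mem /eqP x0; exact: inv_continuous.
Qed.

Lemma normr_sin_le x : `|sin x| <= `|x|.
Proof.
wlog x0 : x / 0 <= x => [H|].
  have [/H//|x0] := leP 0 x.
  by rewrite -normrN -sinN -[X in _ <= X]normrN; apply: H; lra.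
have [c _] := @MVT_segment R sin cos 0 x x0 (fun c _ => is_derive_sin c)
  (continuous_subspaceT (@continuous_sin R)).
rewrite sin0 !subr0 => ->; rewrite normrM ler_piMl//.
by rewrite ler_norml cos_geN1 cos_le1.
Qed.

Lemma cos_ge_quadratic x : 1 - cos x <= x ^+ 2 / 2.
Proof.
have -> : 1 - cos x = 2 * sin (x / 2) ^+ 2.
  have -> : cos x = cos (x / 2 *+ 2) by congr cos; rewrite -mulr_natr; field.
  by rewrite cos_mulr2n -mulr_natl cos2sin2; ring.
have : sin (x / 2) ^+ 2 <= (x / 2) ^+ 2.
  by rewrite -(ger0_norm (sqr_ge0 (sin _))) -(ger0_norm (sqr_ge0 (x / 2)))
    !normrX lerXn2r ?nnegrE// normr_sin_le.
by rewrite expr_div_n; lra.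
Qed.

(* At x = 0 the division gives 0 instead of the limit, so that [fejer] is only
   continuous away from 0. *)
Definition fejer s x : R := (1 - cos (pi * (s * x))) / x ^+ 2.

Lemma fejer_ge0 s x : 0 <= fejer s x.
Proof. by rewrite divr_ge0 ?sqr_ge0// subr_ge0 cos_le1. Qed.

Lemma fejer0 x : fejer 0 x = 0.
Proof. by rewrite /fejer mul0r mulr0 cos0 subrr mul0r. Qed.

Lemma fejerN s x : fejer s (- x) = fejer s x.
Proof. by rewrite /fejer mulrN mulrN cosN sqrrN. Qed.

(** The numerator is at most [(pi s x)^2 / 2] and at most 2. Multiplied by [1 + x ^+ 2], the first
    bound serves the term 1 and the second the term [x ^+ 2], and the two constants add up. *)
Lemma fejer_le s x : fejer s x <= ((pi * s) ^+ 2 / 2 + 2) / (1 + x ^+ 2).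
Proof.
have C0 : 0 <= (pi * s) ^+ 2 / 2 + 2 by rewrite addr_ge0// divr_ge0// sqr_ge0.
have x1 : 0 < 1 + x ^+ 2 by rewrite ltr_wpDr ?sqr_ge0.
have [->|x0] := eqVneq x 0.
  by rewrite /fejer expr0n /= invr0 mulr0 divr_ge0// addr_ge0.
have x2 : 0 < x ^+ 2 by rewrite exprn_even_gt0.
rewrite /fejer ler_pdivrMr// mulrAC ler_pdivlMr//.
have h1 := cos_ge_quadratic (pi * (s * x)).
have h2 := cos_geN1 (pi * (s * x)).
have h3 : (1 - cos (pi * (s * x))) * x ^+ 2 <= 2 * x ^+ 2.
  by apply: ler_wpM2r; [exact: ltW|lra].
rewrite [leLHS]mulrDr mulr1 [leRHS]mulrDl; apply: lerD => //.
by apply: (le_trans h1); rewrite !exprMn; lra.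
Qed.

Lemma integrable_oneDsqrV : mu.-integrable setT (EFin \o (fun x => (1 + x ^+ 2)^-1)).
Proof.
apply/integrableP; split.
  apply/measurable_EFinP; apply: continuous_measurable_fun.
  exact: continuous_oneDsqrV.
under eq_integral do rewrite /= ger0_norm ?invr_ge0 ?addr_ge0 ?sqr_ge0//.
rewrite (ge0_symfun_integralT (f := fun x => (1 + x ^+ 2)^-1)).
- rewrite -set_itvcy.
  by have -> := integral0y_oneDsqr R; rewrite -EFinM ltry.
- by move=> x; rewrite invr_ge0 addr_ge0// sqr_ge0.
- exact: continuous_oneDsqrV.
- by move=> x /=; rewrite sqrrN.
Qed.

Lemma measurable_fejer s : measurable_fun setT (fejer s).
Proof.
apply: measurable_funM; last first.
  apply: (measurableT_comp measurable_invr); exact: exprn_measurable.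
apply: measurable_funB => //; apply: (measurableT_comp (f := cos)).
  exact: continuous_measurable_fun (@continuous_cos R).
apply: (measurableT_comp (f := *%R pi)); exact: mulrl_measurable.
Qed.

Lemma integrable_fejer s : mu.-integrable setT (EFin \o fejer s).
Proof.
have := integrableZl measurableT ((pi * s) ^+ 2 / 2 + 2) integrable_oneDsqrV.
apply: le_integrable => //.
  by apply/measurable_EFinP; exact: measurable_fejer.
move=> x _; rewrite /= lee_fin ger0_norm ?fejer_ge0//.
by rewrite (le_trans (fejer_le _ _))// ler_norm.
Qed.

Definition fejer_mass : R := \int[mu]_x fejer 1 x.

(** Since [fejer s x = s^2 fejer 1 (s x)], the substitution leaves [s^2 / |s|]. This absolute value
    is the origin of the piecewise linear transform below. *)
Lemma Rintegral_fejer s : \int[mu]_x fejer s x = `|s| * fejer_mass.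
Proof.
have [->|s0] := eqVneq s 0.
  under eq_Rintegral do rewrite fejer0.
  by rewrite normr0 mul0r /Rintegral integral0.
have sE x : fejer s x = s ^+ 2 * fejer 1 (s * x + 0).
  rewrite /fejer addr0 mul1r; have [->|x0] := eqVneq x 0.
    by rewrite !mulr0 expr0n invr0 !mulr0.
  by field; rewrite x0 s0.
under eq_Rintegral do rewrite sE.
rewrite RintegralZl//; last exact: integrable_affine (integrable_fejer 1).
rewrite (Rintegral_affine _ s0 (integrable_fejer 1)) mulrA; congr (_ * _).
by rewrite -[s ^+ 2]ger0_norm ?sqr_ge0// normrX expr2 mulfK ?normr_eq0.
Qed.

(** On [[1/2, 1]] the cosine is nonpositive, so the integrand is at least [1 / x^2 >= 1] there. *)
Lemma fejer_mass_gt0 : 0 < fejer_mass.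
Proof.
have mI : measurable (`[1 / 2, 1]%classic : set R) by [].
have fin : (\int[mu]_x (fejer 1 x)%:E)%E \is a fin_num.
  exact: integrable_fin_num (integrable_fejer 1).
rewrite -lte_fin /fejer_mass fineK//.
apply: (@lt_le_trans _ _ (\int[mu]_(x in `[(1 / 2)%R, 1%R]) 1)%E).
  rewrite integral_cst// mul1e.
  have := lebesgue_measure_itv (`[1 / 2, 1] : interval R).
  by rewrite /= lte_fin ifT => [->|]; rewrite -?EFinB ?lte_fin; lra.
apply: (@le_trans _ _ (\int[mu]_(x in `[(1 / 2)%R, 1%R]) (fejer 1 x)%:E)%E).
  apply: ge0_le_integral => //.
  - by apply/measurable_EFinP; apply: measurable_funTS; exact: measurable_fejer.
  - move=> x; rewrite /= in_itv /= => /andP[x1 x2]; rewrite lee_fin /fejer mul1r.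
    have x0 : 0 < x by lra.
    have c0 : cos (pi * x) <= 0.
      rewrite -(subrK (pi / 2) (pi * x)) cosDpihalf oppr_le0 sin_ge0_pi//.
      have := pi_gt0 R => pi0; nra.
    rewrite ler_pdivlMr ?exprn_gt0// mul1r.
    have : x ^+ 2 <= 1 by rewrite expr_le1//; lra.
    by lra.
apply: ge0_subset_integral => //.
- by apply/measurable_EFinP; exact: measurable_fejer.
- by move=> x _; rewrite lee_fin fejer_ge0.
Qed.

(* Its transform, a trapezoid, only requires the scaling law of the integral of
   [fejer]; the value of [fejer_mass] is never needed. *)
Definition trapker p q x : R := (fejer q x - fejer p x) / ((q - p) * fejer_mass).

(** The four absolute values are the masses of the four dilates of [fejer] that multiplication by a
    cosine produces, as in [cos_fejer]. *)
Definition trapezoid p q t : R :=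
  (`|q + t| + `|q - t| - `|p + t| - `|p - t|) / (2 * (q - p)).

Lemma trapezoid1 p q t : p < q -> `|t| <= p -> trapezoid p q t = 1.
Proof.
move=> pq; rewrite ler_norml /trapezoid => /andP[tp1 tp2].
by rewrite !ger0_norm; [field; lra|lra..].
Qed.

Lemma trapezoid0 p q t : 0 <= p -> p < q -> q <= `|t| -> trapezoid p q t = 0.
Proof.
move=> p0 pq; rewrite /trapezoid; have [t0|t0] := ger0P t => qt.
  by rewrite (@ger0_norm _ (q + t)) ?(@ler0_norm _ (q - t))
    ?(@ger0_norm _ (p + t)) ?(@ler0_norm _ (p - t)); [field; lra|lra..].
by rewrite (@ler0_norm _ (q + t)) ?(@ger0_norm _ (q - t))
    ?(@ler0_norm _ (p + t)) ?(@ger0_norm _ (p - t)); [field; lra|lra..].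
Qed.

Lemma integrable_trapker p q : mu.-integrable setT (EFin \o trapker p q).
Proof.
have := integrableZr measurableT ((q - p) * fejer_mass)^-1
  (integrableB measurableT (integrable_fejer q) (integrable_fejer p)).
by apply: eq_integrable.
Qed.

Lemma cintegrable_trapker p q : cintegrable mu (fun x => (trapker p q x)%:C).
Proof. exact: (cintegrable_real (integrable_trapker p q)). Qed.

Lemma trapkerN p q x : trapker p q (- x) = trapker p q x.
Proof. by rewrite /trapker !fejerN. Qed.

(** The product formula for cosines, applied to [cos a (1 - cos b)]. The last term does not depend
    on [s], hence cancels in the difference that defines [trapker]. At [x = 0] all quotients are
    0. *)
Lemma cos_fejer s t x :
  cos (pi * (x * t)) * fejer s x =
  2^-1 * (fejer (s + t) x + fejer (s - t) x) - fejer t x.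
Proof.
rewrite /fejer.
have -> : pi * ((s + t) * x) = pi * (s * x) + pi * (t * x) by ring.
have -> : pi * ((s - t) * x) = pi * (s * x) - pi * (t * x) by ring.
rewrite cosD cosB [x * t]mulrC; have [->|x0] := eqVneq x 0; last by field.
by rewrite expr0n invr0 !mulr0 !addr0 mulr0 subr0.
Qed.

Lemma fourierL1_trapker p q t : p < q ->
  fourierL1 (fun x => (trapker p q x)%:C) t = (trapezoid p q t)%:C.
Proof.
move=> pq; have J0 := fejer_mass_gt0.
have IF := cintegrable_fourier t (cintegrable_trapker p q).
rewrite /fourierL1 /cintegral.
under eq_Rintegral do rewrite ReM /= mulr0 subr0.
under [X in _ +i* X]eq_Rintegral do rewrite ImM /= mulr0 add0r.
congr (_ +i* _).
  have E x : cos (pi * (x * t)) * trapker p q x =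
    ((fejer (q + t) x + fejer (q - t) x) - (fejer (p + t) x + fejer (p - t) x)) *
       (2 * ((q - p) * fejer_mass))^-1.
    rewrite /trapker mulrA mulrBr !cos_fejer; field; lra.
  under eq_Rintegral do rewrite E.
  have ID a b : mu.-integrable setT (EFin \o (fun x => fejer a x + fejer b x)).
    by have := integrableD measurableT (integrable_fejer a) (integrable_fejer b);
      apply: eq_integrable.
  rewrite RintegralZr//; last first.
    by have := integrableB measurableT (ID (q + t) (q - t)) (ID (p + t) (p - t));
      apply: eq_integrable.
  rewrite RintegralB// !RintegralD//; [|exact: integrable_fejer..].
  by rewrite !Rintegral_fejer /trapezoid; field; lra.
(* The imaginary part has an odd integrand: the substitution [x -> - x] shows that its integral
   equals its own opposite. *)
have Is : mu.-integrable setT (EFin \o (fun x => sin (pi * (x * t)) * trapker p q x)).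
  have [_] := IF; apply: eq_integrable => // x _ /=.
  by rewrite mulr0 add0r.
have n1 : (-1 : R) != 0 by rewrite oppr_eq0 oner_neq0.
have := Rintegral_affine 0 n1 Is.
rewrite normrN normr1 invr1 mul1r => E.
have E2 : \int[mu]_x (sin (pi * ((-1 * x + 0) * t)) * trapker p q (-1 * x + 0)) =
   - \int[mu]_x (sin (pi * (x * t)) * trapker p q x).
  rewrite -[RHS]mulN1r -RintegralZl//; apply: eq_Rintegral => x _.
  by rewrite addr0 mulN1r trapkerN mulNr mulrN sinN mulN1r mulNr.
by rewrite E2 in E; lra.
Qed.

End fejer.

(** * Injectivity of the Fourier transform on L^1 *)

Section uniqueness.
Context (R : realType).
Local Notation mu := (@lebesgue_measure R).
Implicit Types (f g h : R -> R[i]) (u : R -> R) (p q s t x : R).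

Lemma normr_trapezoid_le1 p q t : p < q -> `|trapezoid p q t| <= 1.
Proof.
move=> pq; rewrite /trapezoid normrM normfV ler_pdivrMr ?mul1r; last first.
  by rewrite normr_gt0; lra.
rewrite [X in _ <= X]gtr0_norm; last by lra.
have h1 : `|(`|q + t| - `|p + t|)| <= `|q + t - (p + t)| by exact: ler_dist_dist.
have h2 : `|(`|q - t| - `|p - t|)| <= `|q - t - (p - t)| by exact: ler_dist_dist.
have e1 : `|q + t - (p + t)| = q - p by rewrite ger0_norm; lra.
have e2 : `|q - t - (p - t)| = q - p by rewrite ger0_norm; lra.
rewrite e1 ler_norml in h1; rewrite e2 ler_norml in h2.
case/andP: h1 => ? ?; case/andP: h2 => ? ?.
by rewrite ler_norml; apply/andP; split; lra.
Qed.

Lemma measurable_trapezoid p q : measurable_fun setT (trapezoid p q).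
Proof.
have mp (a : R) : measurable_fun setT (fun t : R => `|a + t|).
  by apply: measurableT_comp => //; apply: measurable_funD.
have mm (a : R) : measurable_fun setT (fun t : R => `|a - t|).
  by apply: measurableT_comp => //; apply: measurable_funB.
apply: measurable_funM => //.
by do 2 (apply: measurable_funB => //); apply: measurable_funD.
Qed.

Lemma cvg_trapezoid p t : 0 < p ->
  trapezoid p (p + n.+1%:R^-1) t @[n --> \oo] --> (\1_[set s | `|s| <= p] t : R).
Proof.
move=> p0; have [tp|tp] := leP `|t| p.
  rewrite indicE mem_set//; apply: cvg_near_cst; apply: nearW => n.
  by apply: trapezoid1 => //; rewrite ltrDl.
rewrite indicE memNset /=; last by apply/negP; rewrite -ltNge.
apply: cvg_near_cst; near=> n; apply: trapezoid0; [exact: ltW|by rewrite ltrDl|].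
rewrite -lerBrDl; near: n.
have : `|t| - p > 0 by lra.
move=> tp0; near do apply: ltW; exact: (near_infty_natSinv_lt (PosNum tp0)).
Unshelve. all: by end_near. Qed.

(** The primitive of [u] is constant, and by Lebesgue differentiation its derivative is [u] almost
    everywhere. *)
Lemma ae_eq0_of_itv u : mu.-integrable setT (EFin \o u) ->
  (forall a b, a < b -> \int[mu]_(x in `[a, b]) u x = 0) ->
  {ae mu, forall x, u x = 0}.
Proof.
move=> iu u0.
have iuS (i : interval R) : mu.-integrable [set` i] (EFin \o u).
  exact: integrableS iu.
pose F x := \int[mu]_(t in [set` `]-oo, x]]) u t.
have H : {ae mu, forall x, derivable F x 1 /\ derive1 F x = u x}.
  exact: (FTC1Ny (fun y => iuS `]-oo, y]) (open_integrable_locally openT iu)).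
have Fcst : F = cst (F 0).
  have Fab a b : a < b -> F b = F a.
    move=> ab; apply: subr0_eq.
    rewrite /F Rintegral_itvB//; last by rewrite bnd_simp ltW.
    by rewrite Rintegral_itv_obnd_cbnd// u0.
  by apply/funext => x /=; have [/Fab|/Fab|->] := ltgtP x 0.
move: H; apply: (filterS (Filter := ae_filter_ringOfSetsType mu)) => x [_ <-].
by rewrite Fcst derive1_cst.
Qed.

(* As q decreases to p the trapezoids decrease to the indicator of [-p, p]. *)
Lemma ae_eq0_of_trapezoid u : mu.-integrable setT (EFin \o u) ->
  (forall c p q, 0 < p -> p < q ->
     \int[mu]_x (trapezoid p q (x - c) * u x) = 0) ->
  {ae mu, forall x, u x = 0}.
Proof.
move=> iu u0; apply: ae_eq0_of_itv => // a b ab.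
pose c := (a + b) / 2; pose p := (b - a) / 2.
have p0 : 0 < p by rewrite /p; lra.
have mu_ : measurable_fun setT u by apply/measurable_EFinP; case/integrableP: iu.
have msub : measurable_fun setT (fun x : R => x - c).
  by apply: measurable_funB.
(* The limit of the trapezoids centred at the midpoint [c], with half-width [p], is the indicator of
   [[a, b]]. *)
have itvE x : \1_[set s | `|s| <= p] (x - c) = \1_(`[a, b]%classic) x :> R.
  rewrite !indicE; congr (nat_of_bool _)%:R; apply/idP/idP => /set_mem /= h;
    apply/mem_set; move: h => /=; rewrite in_itv /= ler_norml /c /p.
    by move=> /andP[? ?]; apply/andP; split; lra.
  by move=> /andP[? ?]; apply/andP; split; lra.
have [] := @dominated_convergence _ _ _ mu setT measurableT
  (fun n x => (trapezoid p (p + n.+1%:R^-1) (x - c) * u x)%:E)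
  (fun x => (\1_[set s | `|s| <= p] (x - c) * u x)%:E)
  (fun x => `|u x|%:E).
- move=> n; apply/measurable_EFinP; apply: measurable_funM => //.
  exact: (measurableT_comp (measurable_trapezoid _ _) msub).
- apply/measurable_EFinP; apply: measurable_funM => //.
  by under eq_fun do rewrite itvE; exact: measurable_indic.
- apply: aeW => x _; apply: cvg_EFin; first by apply: nearW.
  by apply: cvgM; [exact: cvg_trapezoid|exact: cvg_cst].
- by have := integrable_abse iu; apply: eq_integrable.
- apply: aeW => x n _; rewrite /= lee_fin normrM ler_piMl//.
  by apply: normr_trapezoid_le1; rewrite ltrDl.
move=> _ _; set S := (X in X @ \oo --> _) => Scvg.
have S0 : S = cst 0%E.
  apply/funext => n; rewrite /S /=.
  have pn : p < p + n.+1%:R^-1 by rewrite ltrDl.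
  have h := u0 c p _ p0 pn; rewrite /Rintegral in h; rewrite -[LHS]fineK ?h//.
  apply: integrable_fin_num => //.
  have := integrable_abse iu; apply: le_integrable => //.
    apply/measurable_EFinP; apply: measurable_funM => //.
    exact: (measurableT_comp (measurable_trapezoid _ _) msub).
  move=> x _; rewrite /= lee_fin normrM normr_id ler_piMl//.
  by apply: normr_trapezoid_le1; rewrite ltrDl.
rewrite S0 in Scvg.
have := cvg_unique _ Scvg (cvg_cst 0%E) => /(_ (@ereal_hausdorff R)) lim0.
rewrite Rintegral_mkcond /Rintegral.
rewrite (_ : (\int[mu]_x _)%E = 0%E)//= -lim0.
apply: eq_integral => x _; rewrite itvE patchE indicE.
by case: ifP; rewrite ?mul1r ?mul0r.
Qed.

Lemma fourierL1_cst0 t : fourierL1 (fun=> 0 : R[i]) t = 0.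
Proof.
rewrite /fourierL1 /cintegral; under eq_Rintegral do rewrite mulr0 /=.
under [X in _ +i* X]eq_Rintegral do rewrite mulr0 /=.
by rewrite /Rintegral !integral0.
Qed.

(** The multiplication formula: integrating [V^(y - c) f(y)] in [y] amounts to integrating
    [V(x) e^(- pi i c x) f^(x)] in [x], where the last factor vanishes. *)
Lemma cintegral_trapezoid f (c p q : R) : cintegrable mu f ->
  (forall t, fourierL1 f t = 0) -> p < q ->
  cintegral mu (fun x => (trapezoid p q (x - c))%:C * f x) = 0.
Proof.
move=> If f0 pq.
pose V x : R[i] := (trapker p q x)%:C.
have IV : cintegrable mu V := cintegrable_trapker p q.
pose A (z : R * R) := expipi (z.1 * (z.2 - c)) * V z.1.
have IA y : cintegrable mu (fun x => A (x, y)) by exact: (cintegrable_fourier (y - c) IV).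
have [mVr mVi] := cintegrable_measurable IV.
have [mV lV] := (cintegrableP mu V).1 IV.
have NV : cL1norm mu V = (fine (cL1norm mu V))%:E.
  by rewrite fineK// ge0_fin_numE// cL1norm_ge0.
have [||_ Fh _] := @kernel_superposition R A f (2 * fine (cL1norm mu V)) _ _ If.
- apply: cmeasurableM.
    apply: cmeasurable_expipi; apply: measurable_funM; first exact: measurable_fst.
    by apply: measurable_funB => //; exact: measurable_snd.
  by split; [exact: (measurableT_comp mVr measurable_fst)|
             exact: (measurableT_comp mVi measurable_fst)].
- move=> y; rewrite EFinM -NV /cL1norm -ge0_integralZl//; last 2 first.
  + exact: measurable_cnorm1E.
  + by move=> x _; rewrite lee_fin cnorm1_ge0.
  apply: ge0_le_integral => //.
  + by move=> x _; rewrite lee_fin cnorm1_ge0.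
  + exact: measurable_cnorm1E (cintegrable_measurable (IA y)).
  + by apply: measurable_funeM; exact: measurable_cnorm1E.
  + move=> x _; rewrite -EFinM lee_fin (le_trans (cnorm1M _ _))//.
    by rewrite ler_wpM2r ?cnorm1_ge0// cnorm1_expipi.
(* At frequency 0 the transform is the plain integral. The superposition vanishes identically, since
   at [x] it is a multiple of [f^(x)]; the other side is the integral against the trapezoid. *)
have := Fh 0.
have -> : (fun x => cintegral mu (fun y => A (x, y) * f y)) = fun=> 0.
  apply/funext => x.
  rewrite (eq_cintegral mu (g := fun y =>
    (expipi (- (x * c)) * V x) * (expipi (y * x) * f y))); last first.
    move=> y; rewrite /A /= mulrBr addrC expipiD [x * y]mulrC.
    by rewrite -!mulrA; congr (_ * _); rewrite mulrCA.
  by rewrite cintegralZ; [rewrite -/(fourierL1 f x) f0 mulr0|exact: cintegrable_fourier].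
rewrite fourierL1_cst0 => ->; apply: eq_cintegral => y; congr (_ * _).
by rewrite /A /= fourierL1_modulation add0r fourierL1_trapker.
Qed.

(** Trapezoids are real, so the vanishing of the complex integrals splits into one statement for
    each of the real and imaginary parts. *)
Theorem fourierL1_eq0 f : cintegrable mu f -> (forall t, fourierL1 f t = 0) ->
  {ae mu, forall x, f x = 0}.
Proof.
move=> If f0; have [Ir Ii] := If.
have T0 c p q : 0 < p -> p < q ->
    cintegral mu (fun x => (trapezoid p q (x - c))%:C * f x) = 0.
  by move=> _; exact: cintegral_trapezoid.
have r0 : {ae mu, forall x, complex.Re (f x) = 0}.
  apply: ae_eq0_of_trapezoid => // c p q p0 pq.
  have := congr1 (@complex.Re R) (T0 c p q p0 pq) => /= <-.
  by apply: eq_Rintegral => x _; rewrite ReM /= mul0r subr0.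
have i0 : {ae mu, forall x, complex.Im (f x) = 0}.
  apply: ae_eq0_of_trapezoid => // c p q p0 pq.
  have := congr1 (@complex.Im R) (T0 c p q p0 pq) => /= <-.
  by apply: eq_Rintegral => x _; rewrite ImM /= mul0r addr0.
apply: (@filterS2 _ _ (ae_filter_ringOfSetsType mu) _ _ _ _ r0 i0) => x.
by case: (f x) => a b /= -> ->.
Qed.

End uniqueness.

(** * Local division of Fourier transforms *)

Section L1_series.
Context d (T : measurableType d) (R : realType).
Variable m : {measure set T -> \bar R}.

(** Completeness of L^1 for absolutely summable series: [S] is integrable, hence finite almost
    everywhere; the series converges where [S] is finite, and [S] dominates the partial sums. *)
Lemma L1_series_real (u : nat -> T -> R) :
  (forall n, m.-integrable setT (EFin \o u n)) ->
  (\sum_(n <oo) \int[m]_x `|u n x|%:E < +oo)%E ->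
  exists U : T -> R, m.-integrable setT (EFin \o U) /\
    (\int[m]_x `|(\sum_(i < N) u i x)%R%:E - (U x)%:E|)%E @[N --> \oo] --> 0%E.
Proof.
move=> iu uoo.
have mu_ n : measurable_fun setT (u n).
  by apply/measurable_EFinP; case/integrableP: (iu n).
have mau n : measurable_fun setT (fun x => `|u n x|%:E).
  by apply/measurable_EFinP; exact: measurableT_comp.
pose S x := (\sum_(n <oo) `|u n x|%:E)%E.
have mS : measurable_fun setT S.
  rewrite /S (_ : (fun x => _) =
      fun x => (\sum_(i <oo | i \in predT) `|u i x|%:E)%E)//.
  exact: ge0_emeasurable_sum.
have S0 x : (0 <= S x)%E by exact: nneseries_ge0.
have iS : m.-integrable setT S.
  apply/integrableP; split => //.
  under eq_integral do rewrite gee0_abs//.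
  by rewrite integral_nneseries.
pose D := [set x | S x < +oo]%E.
have mD : measurable D.
  by rewrite -[D]setTI; exact: emeasurable_fun_infty_o.
have partial_le x N : ((\sum_(i < N) `|u i x|)%:E <= S x)%E.
  by rewrite -sumEFin -(big_mkord predT (fun i => `|u i x|%:E)%E) nneseries_lim_ge.
have cvgD x : D x -> cvgn (series (fun n => u n x)).
  move=> Dx; apply: normed_cvg; apply: nondecreasing_is_cvgn.
    by apply: nondecreasing_series => n _ _ /=.
  exists (fine (S x)) => _ [N _ <-] /=.
  rewrite -lee_fin fineK ?ge0_fin_numE//.
  by rewrite /series /= big_mkord; exact: partial_le.
(* Where [S] is infinite, the value 0 replaces a limit that may not exist; that set is null. *)
pose U := (fun x => limn (series (fun n => u n x))) \_ D.
have cvgU x : D x -> (\sum_(i < N) u i x) @[N --> \oo] --> limn (series (u^~ x)).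
  have <- : series (u^~ x) = (fun N => \sum_(i < N) u i x).
    by apply/funext => N; rewrite /series /= big_mkord.
  exact: cvgD.
have mU : measurable_fun setT U.
  apply/(measurable_restrictT _ mD).
  apply: (measurable_fun_cvg (h := fun N x => \sum_(i < N) u i x)).
    move=> N; apply: measurable_funTS.
    by apply: measurable_sum.
  by move=> x /cvgU.
have mP N : measurable_fun setT (fun x => (\sum_(i < N) u i x)%:E).
  by apply/measurable_EFinP; apply: measurable_sum.
have [||||iU U0 _] := @dominated_convergence _ _ _ m setT measurableT
  (fun N x => (\sum_(i < N) u i x)%:E) (EFin \o U) S mP.
- exact/measurable_EFinP.
- have := integrable_ae measurableT iS.
  apply: (filterS (Filter := ae_filter_ringOfSetsType m)) => x /(_ I) Sfin _.
  have Dx : D x by rewrite /D /= -ge0_fin_numE.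
  apply: cvg_EFin; first exact: nearW.
  rewrite /U patchE mem_set//=.
  exact: cvgU.
- by [].
- apply: aeW => x N _; apply: le_trans (partial_le x N).
  by rewrite /= lee_fin ler_norm_sum.
by exists U.
Qed.

Lemma L1_series (k : nat -> T -> R[i]) :
  (forall n, cintegrable m (k n)) -> (\sum_(n <oo) cL1norm m (k n) < +oo)%E ->
  exists H : T -> R[i], cintegrable m H /\
    cL1norm m (fun x => \sum_(i < N) k i x - H x) @[N --> \oo] --> 0%E.
Proof.
move=> ik koo.
have mk n : cmeasurable (k n) by exact: cintegrable_measurable (ik n).
have part (P : R[i] -> R) : (forall z, `|P z| <= cnorm1 z) ->
    (forall n, m.-integrable setT (EFin \o (fun x => P (k n x)))) ->
    (\sum_(n <oo) \int[m]_x `|P (k n x)|%:E < +oo)%E.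
  move=> Ple iP; apply: le_lt_trans koo; apply: lee_nneseries.
    by move=> *; apply: integral_ge0.
  move=> n _; apply: ge0_le_integral => //.
  - have /integrable_abse := iP n; exact: measurable_int.
  - exact: measurable_cnorm1E.
  - by move=> x _; rewrite lee_fin.
have [Ur [iUr cUr]] := L1_series_real (fun n => (ik n).1)
  (part (@complex.Re R) (@cnorm1_Re R) (fun n => (ik n).1)).
have [Ui [iUi cUi]] := L1_series_real (fun n => (ik n).2)
  (part (@complex.Im R) (@cnorm1_Im R) (fun n => (ik n).2)).
exists (fun x => Ur x +i* Ui x); split; first by [].
have ReS N x : complex.Re (\sum_(i < N) k i x) = \sum_(i < N) complex.Re (k i x).
  by elim/big_rec2: _ => // i y1 y2 _ <-; rewrite ReD.
have ImS N x : complex.Im (\sum_(i < N) k i x) = \sum_(i < N) complex.Im (k i x).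
  by elim/big_rec2: _ => // i y1 y2 _ <-; rewrite ImD.
have E N : cL1norm m (fun x => \sum_(i < N) k i x - (Ur x +i* Ui x)) =
  (\int[m]_x `|(\sum_(i < N) complex.Re (k i x))%R%:E - (Ur x)%:E| +
   \int[m]_x `|(\sum_(i < N) complex.Im (k i x))%R%:E - (Ui x)%:E|)%E.
  have msum (v : nat -> T -> R) : (forall n, measurable_fun setT (v n)) ->
      measurable_fun setT (fun x => \sum_(i < N) v i x).
    by move=> mv; apply: measurable_sum.
  have mU (V : T -> R) : m.-integrable setT (EFin \o V) -> measurable_fun setT V.
    by case/integrableP => /measurable_EFinP.
  have mE (v V : T -> R) : measurable_fun setT v -> measurable_fun setT V ->
      measurable_fun setT (fun x => `|(v x)%:E - (V x)%:E|%E).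
    move=> mv mV; have : measurable_fun setT (EFin \o (fun x => `|v x - V x|)).
      apply/measurable_EFinP; apply: measurableT_comp => //.
      exact: measurable_funB.
    exact.
  rewrite -ge0_integralD//.
  - apply: eq_integral => x _; rewrite /cnorm1 ReD ImD /= ReS ImS.
    by rewrite EFinD.
  - apply: mE; last exact: mU.
    exact: (msum (fun n x => complex.Re (k n x)) (fun n => (mk n).1)).
  - apply: mE; last exact: mU.
    exact: (msum (fun n x => complex.Im (k n x)) (fun n => (mk n).2)).
rewrite (funext E).
by have := cvgeD (isT : (0 +? 0)%E) cUr cUi; rewrite adde0 => H; apply: H.
Qed.

End L1_series.

(** * Neumann series for convolution *)

Section neumann.
Context (R : realType).
Local Notation mu := (@lebesgue_measure R).
Implicit Types (f g h G : R -> R[i]).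

Lemma fourierL1_sum (k : nat -> R -> R[i]) N t :
  (forall n, cintegrable mu (k n)) ->
  cintegrable mu (fun x => \sum_(i < N) k i x) /\
  fourierL1 (fun x => \sum_(i < N) k i x) t = \sum_(i < N) fourierL1 (k i) t.
Proof.
move=> ik; elim: N => [|N [IN FN]].
  rewrite big_ord0 (_ : (fun x => _) = fun=> 0); last first.
    by apply/funext => x; rewrite big_ord0.
  by split; [exact: cintegrable0|exact: fourierL1_cst0].
rewrite big_ord_recr /= -FN (_ : (fun x => _) =
  fun x => \sum_(i < N) k i x + k N x); last first.
  by apply/funext => x; rewrite big_ord_recr.
by split; [exact: cintegrableD|rewrite fourierL1D].
Qed.

Lemma ge0_cvg0_eq0 (a : R) (b : nat -> \bar R) : 0 <= a ->
  (forall n, (a%:E <= b n)%E) -> b @ \oo --> 0%E -> a = 0.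
Proof.
move=> a0 ab b0; apply/eqP; rewrite eq_le a0 andbT -lee_fin.
have := lime_ge (cvgP _ b0) (nearW _ ab).
by rewrite (cvg_lim (@ereal_hausdorff R) b0) => H; apply: H.
Qed.

(* h is the sum of the convolution powers of G applied to f. *)
Lemma neumann_series f G : cintegrable mu f -> cintegrable mu G ->
  (cL1norm mu G <= 2^-1%:E)%E ->
  exists h, cintegrable mu h /\
    forall t, (1 - fourierL1 G t) * fourierL1 h t = fourierL1 f t.
Proof.
move=> If IG GN.
have step_ex h : exists h', cintegrable mu h -> [/\ cintegrable mu h',
    forall t, fourierL1 h' t = fourierL1 G t * fourierL1 h t &
    (cL1norm mu h' <= 2^-1%:E * cL1norm mu h)%E].
  (* Choice needs a total function, so a non-integrable [h] gets itself as a dummy value. *)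
  have [Ih|nIh] := pselect (cintegrable mu h); last by exists h => /nIh.
  have [h' [Ih' Fh' Nh']] := convolution_exists IG Ih.
  exists h' => _; split => //; apply: (le_trans Nh').
  by apply: lee_wpmul2r => //; exact: cL1norm_ge0.
have [step stepP] := choice step_ex.
pose k n := iter n step f.
have Ik n : cintegrable mu (k n) by elim: n => //= n /stepP[].
have Fk n t : fourierL1 (k n) t = fourierL1 G t ^+ n * fourierL1 f t.
  elim: n => [|n IH]; first by rewrite expr0 mul1r.
  by have [_ /= -> _] := stepP _ (Ik n); rewrite -/(k n) IH exprS mulrA.
pose F := fine (cL1norm mu f).
have fin h : cintegrable mu h -> cL1norm mu h = (fine (cL1norm mu h))%:E.
  by move=> /cintegrableP[_ lh]; rewrite fineK// ge0_fin_numE// cL1norm_ge0.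
have F0 : 0 <= F by rewrite fine_ge0// cL1norm_ge0.
(* The bound is [F / 2 ^ n], written with [n.+1] and a factor 2 to fit the shape of
   [epsilon_trick0]. *)
have Nk n : (cL1norm mu (k n) <= (2 * F / (2 ^ n.+1)%:R)%:E)%E.
  elim: n => [|n IH].
    by rewrite expn1 mulrAC divff// mul1r /F -fin.
  have [_ _ Nn] := stepP _ (Ik n); apply: (le_trans Nn).
  have h2 : (0 <= 2^-1%:E :> \bar R)%E by rewrite lee_fin invr_ge0.
  apply: (le_trans (lee_wpmul2l h2 IH)).
  rewrite -EFinM lee_fin [(2 ^ n.+2)%N]expnS natrM.
  by rewrite [X in _ <= X](_ : _ = 2^-1 * (2 * F / (2 ^ n.+1)%:R))//;
    rewrite invfM mulrCA.
have [H [IH cH]] : exists H, cintegrable mu H /\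
    cL1norm mu (fun x => \sum_(i < N) k i x - H x) @[N --> \oo] --> 0%E.
  apply: L1_series => //.
  apply: (@le_lt_trans _ _ (\sum_(n <oo) (2 * F / (2 ^ n.+1)%:R)%:E)%E).
    by apply: lee_nneseries => // *; exact: cL1norm_ge0.
  apply: le_lt_trans (ltry (2 * F)); apply: epsilon_trick0.
  by rewrite mulr_ge0.
exists H; split => // t; set z := fourierL1 G t.
apply/eqP; rewrite -subr_eq0; apply/eqP/cnorm1_eq0.
pose S N x := \sum_(i < N) k i x.
pose D N x := S N x - H x.
(* By telescoping, [1 - z] times the transform of the partial sum [S N] is [f^] minus that of [k N].
   Hence [b N] bounds the defect [(1 - z) H^ - f^] at [t], for every [N], and it tends to 0. *)
pose b N := ((cnorm1 (1 - z))%:E * (2%:E * cL1norm mu (D N)) +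
  2%:E * cL1norm mu (k N))%E.
apply: (@ge0_cvg0_eq0 _ b); first exact: cnorm1_ge0.
  move=> N; have [IS FS] := fourierL1_sum N t Ik.
  have IHm : cintegrable mu (fun x => (-1) * H x) by exact: cintegrableZ.
  have ISH : cintegrable mu (D N).
    have := cintegrableD IS IHm.
    by rewrite /D; under [in X in _ -> X]eq_fun do rewrite -mulN1r.
  have FSH : fourierL1 (D N) t =
      \sum_(i < N) fourierL1 (k i) t - fourierL1 H t.
    rewrite -FS -mulN1r -fourierL1Z// -fourierL1D//; congr fourierL1.
    by apply/funext => x; rewrite mulN1r.
  have telescope : (1 - z) * \sum_(i < N) fourierL1 (k i) t =
      fourierL1 f t - fourierL1 (k N) t.
    rewrite Fk; under eq_bigr do rewrite Fk.
    rewrite -mulr_suml mulrA -/z.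
    have -> : (1 - z) * (\sum_(i < N) z ^+ i) = 1 - z ^+ N.
      by rewrite -[in RHS](expr1n _ N) subrXX; under [in RHS]eq_bigr do rewrite expr1n mul1r.
    by rewrite mulrBl mul1r.
  have -> : (1 - z) * fourierL1 H t - fourierL1 f t =
    - ((1 - z) * fourierL1 (D N) t + fourierL1 (k N) t).
    rewrite FSH mulrBr telescope; ring.
  rewrite cnorm1N; apply: (@le_trans _ _
    ((cnorm1 (1 - z))%:E * (cnorm1 (fourierL1 (D N) t))%:E +
     (cnorm1 (fourierL1 (k N) t))%:E)%E).
    rewrite -EFinM -EFinD lee_fin; apply: (le_trans (cnorm1D _ _)).
    by rewrite lerD2r cnorm1M.
  apply: leeD; last exact: cnorm1_fourierL1.
  by apply: lee_wpmul2l; [rewrite lee_fin cnorm1_ge0|exact: cnorm1_fourierL1].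
have kN0 : cL1norm mu (k N) @[N --> \oo] --> 0%E.
  apply: (@squeeze_cvge _ _ _ _ (cst 0%E) _ (fun N => (geometric F 2^-1 N)%:E)).
  - apply: nearW => N; rewrite cL1norm_ge0 /=; apply: (le_trans (Nk N)).
    rewrite lee_fin natrX exprS exprVn (_ : _ / _ = F / 2 ^+ N)//.
    by field; rewrite expf_neq0.
  - exact: cvg_cst.
  - apply: cvg_EFin; first exact: nearW.
    by apply: cvg_geometric; rewrite ger0_norm ?invr_ge0// invf_lt1// ltr1n.
have c2 (w : nat -> \bar R) (r : R) : w @ \oo --> 0%E ->
    (r%:E * w n)%E @[n --> \oo] --> 0%E.
  by move=> w0; have := cvgeZl (isT : r%:E \is a fin_num) w0; rewrite mule0 => H'; apply: H'.
have := cvgeD (isT : (0 +? 0)%E) (c2 _ (cnorm1 (1 - z)) (c2 _ 2 cH)) (c2 _ 2 kN0).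
by rewrite adde0 => H'; apply: H'.
Qed.

End neumann.

(** * Small increments and Wiener's division *)

Section local_division.
Context (R : realType).
Local Notation mu := (@lebesgue_measure R).
Implicit Types (f g h G : R -> R[i]).

Local Notation V := (@trapker R 1 2).

(** All dilates reduce to [V], so that one modulus of continuity controls them. *)
Lemma trapker_scale (l x : R) : 0 < l -> trapker l (2 * l) x = l * V (l * x).
Proof.
move=> l0; have J0 := fejer_mass_gt0 R; rewrite /trapker /fejer.
have -> : 2 * l * x = 2 * (l * x) by ring.
rewrite mul1r; have [->|x0] := eqVneq x 0.
  by rewrite !mulr0 expr0n invr0 !mulr0 subrr !mul0r mulr0.
by field; rewrite x0 !gt_eqF//=; lra.
Qed.

Lemma fejer_continuous (s x : R) : x != 0 -> {for x, continuous (fejer s)}.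
Proof.
move=> x0; apply: (@cvgM R R); last first.
  by apply: cvgV; [rewrite expf_neq0|exact: exprn_continuous].
apply: (@cvgB R R); first exact: cvg_cst.
apply: (@continuous_comp _ _ _ (fun y => pi * (s * y)) cos).
  by apply: (@cvgM R R); [exact: cvg_cst|apply: (@cvgM R R); [exact: cvg_cst|exact: cvg_id]].
exact: continuous_cos.
Qed.

Lemma trapker_continuous (x : R) : x != 0 -> {for x, continuous V}.
Proof.
move=> x0; apply: (@cvgM R R); last exact: cvg_cst.
by apply: (@cvgB R R); exact: fejer_continuous.
Qed.

Lemma measurable_trapker (p q : R) : measurable_fun setT (trapker p q).
Proof. by apply/measurable_EFinP; case/integrableP: (integrable_trapker p q). Qed.

(** The decay that lets a single integrable function dominate all translates of [V] by at most 1. *)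
Lemma trapker_le : exists2 K : R, 0 <= K & forall x, `|V x| <= K / (1 + x ^+ 2).
Proof.
have J0 := fejer_mass_gt0 R.
pose C (s : R) : R := (pi * s) ^+ 2 / 2 + 2.
have C0 s : 0 <= C s by rewrite addr_ge0// divr_ge0// sqr_ge0.
exists ((C 2 + C 1) / fejer_mass R).
  by apply: divr_ge0; [exact: addr_ge0|exact: ltW].
move=> x; rewrite /trapker (_ : (2 - 1) * _ = fejer_mass R); last by ring.
rewrite normrM normfV (gtr0_norm J0) mulrAC ler_pM2r ?invr_gt0// mulrDl.
apply: (le_trans (ler_normB _ _)).
by apply: lerD; rewrite ger0_norm ?fejer_ge0// fejer_le.
Qed.

(** The L^1 modulus of continuity of [V] under translation. *)
Definition trapker_modulus (s : R) : \bar R := (\int[mu]_x `|V (x - s) - V x|%:E)%E.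

Let mshift (s : R) : measurable_fun setT (fun x : R => V (x - s)).
Proof.
apply: (measurableT_comp (measurable_trapker 1 2)).
exact: measurable_funB.
Qed.

Lemma trapker_modulus_le : exists C : R, forall s, (trapker_modulus s <= C%:E)%E.
Proof.
have IV := integrable_trapker (1 : R) 2.
have INV : mu.-integrable setT (fun x => `|V x|%:E).
  by have := integrable_abse IV; apply: eq_integrable.
have mN : measurable_fun setT (fun x => `|V x|%:E) by exact: measurable_int INV.
pose N := (\int[mu]_x `|V x|%:E)%E.
have Nfin : N \is a fin_num by exact: integrable_fin_num INV.
exists (fine N + fine N) => s; rewrite EFinD fineK//.
have sE : (\int[mu]_x `|V (x - s)|%:E)%E = N.
  rewrite /N [RHS](@ge0_integral_affine _ 1 (- s)) ?oner_neq0//.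
  by rewrite normr1 mul1e; apply: eq_integral => x _; rewrite mul1r.
rewrite -[X in (_ <= X + _)%E]sE -ge0_integralD//; last first.
  by apply/measurable_EFinP; apply: measurableT_comp => //; exact: mshift.
apply: ge0_le_integral => //.
- apply/measurable_EFinP; apply: measurableT_comp => //; apply: measurable_funB.
    exact: mshift.
  exact: measurable_trapker.
- apply: emeasurable_funD => //.
  by apply/measurable_EFinP; apply: measurableT_comp => //; exact: mshift.
- by move=> x _; rewrite -EFinD lee_fin ler_normB.
Qed.

(** Continuity of translation in L^1, obtained for this [V] by dominated convergence: the integrand
    tends to 0 except perhaps at [x = 0], where [V] takes a conventional value. *)
Lemma cvg_trapker_modulus (y : R) :
  trapker_modulus (n.+1%:R^-1 * y) @[n --> \oo] --> 0%E.
Proof.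
(* Dropping the first [N] terms keeps all shifts in [[-1, 1]], where one majorant suffices. *)
pose N := Num.bound `|y|.
rewrite -(cvg_shiftn N); pose s n : R := (n + N).+1%:R^-1 * y.
have s1 n : `|s n| <= 1.
  have -> : `|s n| = `|y| / (n + N).+1%:R.
    by rewrite /s mulrC normrM normfV normr_nat.
  rewrite ler_pdivrMr// mul1r.
  apply: (le_trans (ltW (archi_boundP (normr_ge0 _)))).
  by rewrite ler_nat leqW// leq_addl.
have s0 : s @ \oo --> 0.
  have h : (n + N).+1%:R^-1 @[n --> \oo] --> (0 : R).
    by have := @cvg_harmonic R; rewrite -(cvg_shiftn N).
  by have := cvgM h (cvg_cst y); rewrite mul0r => H; apply: H.
have [K K0 VK] := trapker_le.
have [|||||_ + _] := @dominated_convergence _ _ _ mu setT measurableT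
  (fun n x => (V (x - s n) - V x)%:E) (cst 0%E)
  (fun x => (4 * K * (1 + x ^+ 2)^-1)%:E).
- move=> n; apply/measurable_EFinP; apply: measurable_funB.
    exact: mshift.
  exact: measurable_trapker.
- exact: measurable_cst.
- exists [set 0 : R]; split => //; first exact: lebesgue_measure_set1.
  move=> x /= nx; apply: contrapT => /eqP x0; apply: nx => _.
  apply: cvg_EFin; first exact: nearW.
  have xs : x - s n @[n --> \oo] --> x.
    have := @cvgB R R _ _ _ _ _ _ _ (cvg_cst x) s0.
    by rewrite subr0 => H; apply: H.
  have VV : V (x - s n) @[n --> \oo] --> V x.
    exact: (continuous_cvg _ (trapker_continuous x0) xs).
  have := @cvgB R R _ _ _ _ _ _ _ VV (cvg_cst (V x)).
  by rewrite subrr => H; apply: H.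
- have := integrableZl measurableT (4 * K) (@integrable_oneDsqrV R).
  by apply: eq_integrable.
- apply: aeW => x n _; rewrite /= lee_fin.
  apply: (le_trans (ler_normB _ _)).
  (* For [|s| <= 1] one has [1 + x^2 <= 3 (1 + (x - s)^2)]: the translate accounts for 3 of the 4
     and [V] itself for the remaining 1. *)
  have -> : 4 * K * (1 + x ^+ 2)^-1 = K * (3 / (1 + x ^+ 2)) + K / (1 + x ^+ 2).
    by field; rewrite gt_eqF// ltr_wpDr ?sqr_ge0.
  apply: lerD => //; apply: (le_trans (VK _)); apply: ler_wpM2l => //.
  have x1 (z : R) : 0 < 1 + z ^+ 2 by rewrite ltr_wpDr ?sqr_ge0.
  rewrite ler_pdivlMr// mulrC ler_pdivrMr//.
  have s2 : s n ^+ 2 <= 1.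
    by rewrite -(ger0_norm (sqr_ge0 _)) normrX expr_le1.
  have := sqr_ge0 (x - s n - s n); nra.
move=> H; rewrite /trapker_modulus.
have -> : [sequence trapker_modulus ((n + N).+1%:R^-1 * y)]_n =
    (fun n => \int[mu]_x `|(V (x - s n) - V x)%:E - 0|)%E.
  apply/funext => n /=; apply: eq_integral => x _.
  by rewrite /= ?subr0.
exact: H.
Qed.

(* G is W * g - g^(0) W, where W(x) = l V(l x) has transform 1 on [-l, l]; its
   norm is at most the integral of |g(y)| |V(. - l y) - V|_1, small with l. *)
Lemma local_increment g (e : R) : cintegrable mu g -> 0 < e ->
  exists (l : R) G, [/\ 0 < l, cintegrable mu G, (cL1norm mu G <= e%:E)%E &
    forall t, `|t| <= l -> fourierL1 G t = fourierL1 g t - fourierL1 g 0].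
Proof.
move=> Ig e0; have [mg lg] := (cintegrableP mu g).1 Ig.
have [C VC] := trapker_modulus_le.
pose l n : R := n.+1%:R^-1.
have l0 n : 0 < l n by rewrite invr_gt0.
pose W n x : R[i] := (trapker (l n) (2 * l n) x)%:C.
have IW n : cintegrable mu (W n) by exact: cintegrable_trapker.
pose A n (z : R * R) : R[i] := W n (z.1 - z.2) - W n z.1.
have mA n : cmeasurable (A n).
  have mW := @measurable_trapker (l n) (2 * l n).
  have mB : measurable_fun setT (fun z : R * R => z.1 - z.2).
    exact: (measurable_funB measurable_fst measurable_snd).
  have -> : A n = fun z => (trapker (l n) (2 * l n) (z.1 - z.2) -
      trapker (l n) (2 * l n) z.1)%:C.
    by apply/funext => z; rewrite /A /W -rmorphB.
  apply: cmeasurable_real; apply: measurable_funB.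
    exact: (measurableT_comp mW mB).
  exact: (measurableT_comp mW measurable_fst).
have NA n y : cL1norm mu (fun x => A n (x, y)) = trapker_modulus (l n * y).
  rewrite /trapker_modulus (@ge0_integral_affine _ (l n) 0) ?gt_eqF//; last first.
    apply/measurable_EFinP; apply: measurableT_comp => //; apply: measurable_funB.
      exact: mshift.
    exact: measurable_trapker.
  rewrite -ge0_integralZl//; last first.
    apply/measurable_EFinP; apply: measurableT_comp => //.
    have maff : measurable_fun setT (fun x : R => l n * x + 0).
      by apply: measurable_funD => //; exact: mulrl_measurable.
    apply: measurable_funB.
      exact: (measurableT_comp (mshift _) maff).
    exact: (measurableT_comp (measurable_trapker _ _) maff).
  apply: eq_integral => x _; rewrite /A /W /= -rmorphB cnorm1_real.
  rewrite !trapker_scale// -mulrBr normrM -EFinM addr0.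
  by congr (_ * `|V _ - _|)%:E; rewrite mulrBr.
have NC n y : (cL1norm mu (fun x => A n (x, y)) <= C%:E)%E by rewrite NA.
pose I n := (\int[mu]_y (cL1norm mu (fun x => A n (x, y)) * (cnorm1 (g y))%:E))%E.
have I0 : I @ \oo --> 0%E.
  have [|||||_ _] := @dominated_convergence _ _ _ mu setT measurableT
    (fun n y => (cL1norm mu (fun x => A n (x, y)) * (cnorm1 (g y))%:E)%E) (cst 0%E)
    (fun y => C%:E * (cnorm1 (g y))%:E)%E.
  - move=> n; apply: emeasurable_funM; first exact: measurable_cL1norm_section.
    exact: measurable_cnorm1E.
  - exact: measurable_cst.
  - apply: aeW => y _; under eq_cvg do rewrite NA.
    have := cvgeZr (isT : (cnorm1 (g y))%:E \is a fin_num) (cvg_trapker_modulus y).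
    by rewrite mul0e => H; apply: H.
  - exact: (integrableZl measurableT C (integrable_cnorm1 Ig)).
  - apply: aeW => y n _; rewrite gee0_abs.
      by apply: lee_wpmul2r => //; rewrite lee_fin cnorm1_ge0.
    by rewrite mule_ge0 ?cL1norm_ge0// lee_fin cnorm1_ge0.
  by rewrite integral0.
have [n In] : exists n, (I n < e%:E)%E.
  apply: contrapT => /forallNP nI.
  have := ge0_cvg0_eq0 (ltW e0) _ I0 => e00.
  suff : e = 0 by move=> E; rewrite E ltxx in e0.
  by apply: e00 => n; rewrite leNgt; apply/negP/nI.
have [IG FG NG] := @kernel_superposition R (A n) g C (mA n) (NC n) Ig.
exists (l n); eexists; split; [exact: l0|exact: IG|exact: le_trans NG (ltW In)|].
move=> t tl; rewrite FG.
(* The condition [|t| <= l] enters here: [W n] has transform 1 at [t], so the column of [y] has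
   transform [expipi (y * t) - 1], which integrates against [g] to [g^(t) - g^(0)]. *)
have FA y : fourierL1 (fun x => A n (x, y)) t = expipi (y * t) - 1.
  have IWy : cintegrable mu (fun x => W n (x - y)).
    have := cintegrable_affine (- y) (oner_neq0 R) (IW n).
    by under eq_fun do rewrite mul1r.
  have IWm : cintegrable mu (fun x => (-1) * W n x) by exact: cintegrableZ.
  have -> : (fun x => A n (x, y)) = fun x => W n (x - y) + (-1) * W n x.
    by apply/funext => x; rewrite mulN1r.
  rewrite fourierL1D// fourierL1Z// fourierL1_shift//.
  rewrite fourierL1_trapker; last by have := l0 n; lra.
  by rewrite trapezoid1//; [rewrite mulr1 mulr1|have := l0 n; lra].
have IE : cintegrable mu (fun y => expipi (y * 0) * g y) by exact: cintegrable_fourier.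
have := cintegralD (cintegrable_fourier t Ig) (cintegrableZ (-1) IE).
rewrite cintegralZ// mulN1r -/(fourierL1 g t) -/(fourierL1 g 0) => <-.
apply: eq_cintegral => y; rewrite FA mulrBl mulr0 expipi0 mulN1r mul1r.
by [].
Qed.

Lemma cL1normZ (z : R[i]) h : cintegrable mu h ->
  (cL1norm mu (fun x => z * h x)%R <= (cnorm1 z)%:E * cL1norm mu h)%E.
Proof.
move=> Ih; have mh := measurable_cnorm1E (cintegrable_measurable Ih).
rewrite /cL1norm -ge0_integralZl//; last 2 first.
- by move=> x _; rewrite lee_fin cnorm1_ge0.
- by rewrite lee_fin cnorm1_ge0.
apply: ge0_le_integral => //.
- by move=> x _; rewrite lee_fin cnorm1_ge0.
- exact: measurable_cnorm1E (cintegrable_measurable (cintegrableZ z Ih)).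
- exact: measurable_funeM.
- by move=> x _; rewrite -EFinM lee_fin cnorm1M.
Qed.

(** Near 0, [g^ = c + G^ = c (1 - (- c^-1 G)^)] with [G] small, so the Neumann series with kernel
    [- c^-1 G], applied to [c^-1 f], performs the division. *)
Let division0 f g : cintegrable mu f -> cintegrable mu g ->
  fourierL1 g 0 != 0 -> exists (l : R) h, [/\ 0 < l, cintegrable mu h &
    forall t, `|t| <= l -> fourierL1 g t * fourierL1 h t = fourierL1 f t].
Proof.
move=> If Ig; set c := fourierL1 g 0 => c0.
(* Chosen so that [- c^-1 G] has norm at most 1/2; the summand 1 makes positivity immediate. *)
pose e : R := (2 * (cnorm1 c^-1 + 1))^-1.
have n0 := cnorm1_ge0 c^-1.
have e0 : 0 < e by rewrite invr_gt0; lra.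
have [l [G [l0 IG NG FG]]] := local_increment Ig e0.
have IG' : cintegrable mu (fun x => - c^-1 * G x) by exact: cintegrableZ.
have NG' : (cL1norm mu (fun x => - c^-1 * G x)%R <= 2^-1%:E)%E.
  apply: (le_trans (cL1normZ _ IG)); rewrite cnorm1N.
  apply: (@le_trans _ _ ((cnorm1 c^-1)%:E * e%:E)%E).
    by apply: lee_wpmul2l => //; rewrite lee_fin.
  rewrite -EFinM lee_fin /e ler_pdivrMr; last lra.
  by rewrite mulKf//; lra.
have [h [Ih Fh]] := neumann_series (cintegrableZ c^-1 If) IG' NG'.
exists l, h; split => // t tl; have := Fh t.
rewrite !fourierL1Z// FG// => E; apply: (mulfI (x := c^-1)); first by rewrite invr_eq0.
by rewrite -E mulrA -/c; congr (_ * _); rewrite mulNr opprK mulrBr mulVf// addrCA subrr addr0.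
Qed.

(** Modulating [f] and [g] by [t0] moves the point to 0, and modulating the quotient by [- t0] moves
    it back. *)
Theorem wiener_division f g t0 : cintegrable mu f -> cintegrable mu g ->
  fourierL1 g t0 != 0 -> exists (l : R) h, [/\ 0 < l, cintegrable mu h &
    forall t, `|t - t0| <= l -> fourierL1 g t * fourierL1 h t = fourierL1 f t].
Proof.
move=> If Ig g0.
have [|l [h [l0 Ih Fh]]] := division0 (cintegrable_fourier t0 If)
  (cintegrable_fourier t0 Ig).
  by rewrite fourierL1_modulation add0r.
exists l, (fun x => expipi (x * - t0) * h x); split => //.
  exact: cintegrable_fourier.
move=> t /Fh; rewrite !fourierL1_modulation subrK => <-.
by [].
Qed.

(** A function whose transform is 1 within distance 1 of [t0] can be divided by [g] there; a product
    equal to 1 has no zero factor. *)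
Lemma fourierL1_neq0_near g t0 : cintegrable mu g -> fourierL1 g t0 != 0 ->
  exists2 l : R, 0 < l & forall t, `|t - t0| <= l -> fourierL1 g t != 0.
Proof.
move=> Ig g0.
have IV := cintegrable_fourier (- t0) (cintegrable_trapker (1 : R) 2).
have [l [h [l0 _ Fh]]] := wiener_division IV Ig g0.
exists (Num.min l 1); first by rewrite lt_min l0 ltr01.
move=> t; rewrite le_min => /andP[/Fh + t1].
rewrite fourierL1_modulation fourierL1_trapker; last by lra.
rewrite trapezoid1//; last by lra.
move=> E; apply/eqP => g00; move: E; rewrite g00 mul0r => /eqP.
by rewrite eq_sym oner_eq0.
Qed.

End local_division.

(** * Densities of complex measures *)

Section charge_density.
Context d (T : measurableType d) (R : realType).
Variables (M : {sigma_finite_measure set T -> \bar R}).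
Implicit Types (nu : {charge set T -> \bar R}) (F phi : T -> R).

Definition has_density nu F :=
  M.-integrable setT (EFin \o F) /\
  forall A, measurable A -> nu A = (\int[M]_(x in A) (F x)%:E)%E.

Let bounded_integrable (m : {measure set T -> \bar R}) phi F (B : R) :
  measurable_fun setT phi -> (forall x, `|phi x| <= B) ->
  m.-integrable setT (EFin \o F) ->
  m.-integrable setT (EFin \o (fun x => phi x * F x)).
Proof.
move=> mphi phiB IF.
have := integrableZl measurableT B IF; apply: le_integrable => //.
  apply/measurable_EFinP; apply: measurable_funM => //.
  by apply/measurable_EFinP; case/integrableP: IF.
move=> x _; rewrite /= lee_fin !normrM ler_wpM2r//.
by rewrite (le_trans (phiB x))// ler_norm.
Qed.

Let finite_density (p : {finite_measure set T -> \bar R}) : p `<< M ->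
  exists G : T -> R, [/\ M.-integrable setT (EFin \o G),
    forall A, measurable A -> p A = (\int[M]_(x in A) (G x)%:E)%E &
    forall phi (B : R), measurable_fun setT phi -> (forall x, `|phi x| <= B) ->
      \int[p]_x phi x = \int[M]_x (phi x * G x)].
Proof.
move=> pM; pose D := Radon_Nikodym (charge_of_finite_measure p) M.
have Dfin x : D x \is a fin_num by exact: Radon_Nikodym_fin_num.
have DE : D = EFin \o (fun x => fine (D x)) by apply/funext => x /=; rewrite fineK.
exists (fun x => fine (D x)); split.
- by rewrite -DE; exact: Radon_Nikodym_integrable.
- move=> A mA.
  rewrite [LHS](@Radon_Nikodym_integral _ _ _ (charge_of_finite_measure p) M A pM mA).
  by apply: eq_integral => x _; rewrite -/D fineK.
- move=> phi B mphi phiB; rewrite /Rintegral; congr fine.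
  have Ip : p.-integrable setT (EFin \o phi).
    have IB : p.-integrable setT (EFin \o cst B).
      exact: finite_measure_integrable_cst.
    apply: (le_integrable measurableT _ _ IB).
      exact/measurable_EFinP.
    by move=> x _; rewrite /= lee_fin (le_trans (phiB x))// ler_norm.
  have := Radon_Nikodym_change_of_variables pM measurableT Ip => <-.
  by apply: eq_integral => x _; rewrite -/D EFinM /= fineK.
Qed.

(** The Jordan parts come from a chosen Hahn decomposition, so their densities are not read off from
    [F]. Radon-Nikodym supplies densities [G] and [K], and [G - K = F] almost everywhere because
    both integrate to [nu] over every measurable set. *)
Lemma charge_Rintegral nu F phi (B : R) : has_density nu F ->
  measurable_fun setT phi -> (forall x, `|phi x| <= B) ->
  \int[charge_pos nu]_x phi x - \int[charge_neg nu]_x phi x =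
  \int[M]_x (phi x * F x).
Proof.
move=> [IF nuF] mphi phiB.
have nuM : nu `<< M.
  apply/null_content_dominatesP => A mA MA0; rewrite nuF//.
  apply: null_set_integral => //; apply: measurable_funTS.
  by case/integrableP: IF.
rewrite /charge_pos /charge_neg; set H := projT2 _.
have [G [IG GE Gphi]] := finite_density (jordan_pos_dominates H nuM).
have [K [IK KE Kphi]] := finite_density (jordan_neg_dominates H nuM).
have -> : \int[(jordan_pos H : {measure set T -> \bar R})]_x phi x =
    \int[M]_x (phi x * G x) by rewrite -(Gphi _ _ mphi phiB).
have -> : \int[(jordan_neg H : {measure set T -> \bar R})]_x phi x =
    \int[M]_x (phi x * K x) by rewrite -(Kphi _ _ mphi phiB).
rewrite -RintegralB//; [|exact: bounded_integrable phiB _..].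
have IGK : M.-integrable setT (EFin \o (fun x => G x - K x)).
  by have := integrableB measurableT IG IK; apply: eq_integrable.
have GKF : ae_eq M setT (EFin \o (fun x => G x - K x)) (EFin \o F).
  apply: integral_ae_eq => //; first by case/integrableP: IF.
  move=> A _ mA; rewrite -nuF//.
  have -> : nu A = (jordan_pos H A - jordan_neg H A)%E.
    by rewrite (jordan_decomp H mA) /cadd /= cscaleN1.
  rewrite [jordan_pos H A]GE// [jordan_neg H A]KE// -integralB//.
  - exact: integrableS IG.
  - exact: integrableS IK.
rewrite /Rintegral; congr fine; apply: ae_eq_integral => //.
- apply/measurable_EFinP; apply: measurable_funB.
    have /integrableP[/measurable_EFinP //] := bounded_integrable mphi phiB IG.
  by have /integrableP[/measurable_EFinP //] := bounded_integrable mphi phiB IK.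
- by have /integrableP[] := bounded_integrable mphi phiB IF.
- move: GKF; apply: (filterS (Filter := ae_filter_ringOfSetsType M)) => x /(_ I) /= [E] _.
  by rewrite -mulrBr E.
Qed.

Lemma charge_integral_density nu F (phi : T -> R[i]) (B : R) : has_density nu F ->
  cmeasurable phi -> (forall x, cnorm1 (phi x) <= B) ->
  charge_integral nu phi = cintegral M (fun x => phi x * (F x)%:C).
Proof.
move=> nuF [mr mi] phiB; rewrite /charge_integral /cintegral.
have rB x : `|complex.Re (phi x)| <= B := le_trans (cnorm1_Re _) (phiB x).
have iB x : `|complex.Im (phi x)| <= B := le_trans (cnorm1_Im _) (phiB x).
have Er := charge_Rintegral nuF mr rB; have Ei := charge_Rintegral nuF mi iB.
apply/eqP; rewrite eq_complex /= Er Ei; apply/andP; split; apply/eqP.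
  by apply: eq_Rintegral => x _; rewrite ReM /= mulr0 subr0.
by apply: eq_Rintegral => x _; rewrite ImM /= mulr0 add0r.
Qed.

Definition cm_density (mu : complex_measure T R) (Phi : T -> R[i]) :=
  has_density (cm_re mu) (fun x => complex.Re (Phi x)) /\
  has_density (cm_im mu) (fun x => complex.Im (Phi x)).

Lemma cm_density_integrable mu Phi : cm_density mu Phi -> cintegrable M Phi.
Proof. by move=> [[? _] [? _]]. Qed.

Lemma cm_density_ex (mu : complex_measure T R) :
  (forall A, measurable A -> M A = 0%E -> cm_eval mu A = 0) ->
  exists Phi, cm_density mu Phi.
Proof.
move=> muM.
have ex nu : (forall A, measurable A -> M A = 0%E -> fine (nu A) = 0) ->
    exists F, has_density nu F.
  move=> nu0; have nuM : nu `<< M.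
    apply/null_content_dominatesP => A mA MA0.
    by rewrite -[nu A]fineK ?fin_num_measure// nu0.
  have DE : Radon_Nikodym nu M = EFin \o (fun x => fine (Radon_Nikodym nu M x)).
    by apply/funext => x /=; rewrite fineK//; exact: Radon_Nikodym_fin_num.
  exists (fun x => fine (Radon_Nikodym nu M x)); split.
    by rewrite -DE; exact: Radon_Nikodym_integrable.
  move=> A mA; rewrite (Radon_Nikodym_integral nuM mA).
  by apply: eq_integral => x _; rewrite [in LHS]DE.
have [A mA MA|Fr dr] := ex (cm_re mu).
  by have := congr1 (@complex.Re R) (muM A mA MA).
have [A mA MA|Fi di] := ex (cm_im mu).
  by have := congr1 (@complex.Im R) (muM A mA MA).
by exists (fun x => Fr x +i* Fi x).
Qed.

Lemma density_cm_ex Phi : cintegrable M Phi -> exists mu, cm_density mu Phi.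
Proof.
move=> [rP iP].
pose nr : {charge set T -> \bar R} := induced_charge rP.
pose ni : {charge set T -> \bar R} := induced_charge iP.
by exists (ComplexMeasure nr ni).
Qed.

Lemma cm_integral_density mu Phi (phi : T -> R[i]) (B : R) : cm_density mu Phi ->
  cmeasurable phi -> (forall x, cnorm1 (phi x) <= B) ->
  cm_integral mu phi = cintegral M (fun x => phi x * Phi x).
Proof.
move=> [dr di] mphi phiB; rewrite /cm_integral.
rewrite (charge_integral_density dr mphi phiB) (charge_integral_density di mphi phiB).
have Ir : cintegrable M (fun x => phi x * (complex.Re (Phi x))%:C).
  by apply: (cintegrableM mphi phiB); apply: cintegrable_real; case: dr.
have Ii : cintegrable M (fun x => phi x * (complex.Im (Phi x))%:C).
  by apply: (cintegrableM mphi phiB); apply: cintegrable_real; case: di.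
rewrite -cintegralZ// -cintegralD//; last exact: cintegrableZ.
apply: eq_cintegral => x; rewrite mulrCA -mulrDr; congr (_ * _).
case: (Phi x) => a b /=; apply/eqP.
by rewrite eq_complex ReD ImD ReM ImM /= !mul0r !mul1r subrr !addr0 !add0r !eqxx.
Qed.

Lemma cm_eval_density_null mu Phi A : cm_density mu Phi -> measurable A ->
  M A = 0%E -> cm_eval mu A = 0.
Proof.
move=> [[Ir dr] [Ii di]] mA MA; rewrite /cm_eval dr// di//.
rewrite !null_set_integral//; apply: measurable_funTS.
  by case/integrableP: Ii.
by case/integrableP: Ir.
Qed.

Lemma cm_eval_density_eq0 mu Phi A : cm_density mu Phi -> measurable A ->
  cL1norm M Phi = 0%E -> cm_eval mu A = 0.
Proof.
move=> dP mA P0; have IP := cm_density_integrable dP.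
have mN := measurable_cnorm1E (cintegrable_measurable IP).
have zero (F : T -> R) : M.-integrable setT (EFin \o F) ->
    (forall x, `|F x| <= cnorm1 (Phi x)) -> (\int[M]_(x in A) (F x)%:E)%E = 0%E.
  move=> IF FP; have /integrableP[mF _] := IF.
  apply/eqP; rewrite -abse_eq0 eq_le abse_ge0 andbT -P0.
  apply: (le_trans (le_abse_integral _ mA _)); first exact: measurable_funTS.
  apply: (@le_trans _ _ (\int[M]_x `|(F x)%:E|)%E).
    by apply: ge0_subset_integral => //; exact: measurableT_comp.
  apply: ge0_le_integral => //; first exact: measurableT_comp.
  by move=> x _; rewrite lee_fin.
case: dP => -[Ir dr] [Ii di]; rewrite /cm_eval dr// di// !zero// => x.
  exact: cnorm1_Im.
exact: cnorm1_Re.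
Qed.

(** Integrals against a complex measure are defined through Jordan parts, not through [cm_eval]. The
    density 0 makes the transform of a vanishing measure computable. *)
Lemma cm_density_cst0 (mu : complex_measure T R) :
  (forall A, measurable A -> cm_eval mu A = 0) -> cm_density mu (cst 0).
Proof.
move=> mu0.
have z nu : (forall A, measurable A -> fine (nu A) = 0) -> has_density nu (cst 0).
  move=> nu0; split; first exact: integrable0.
  by move=> A mA; rewrite integral0 -[nu A]fineK ?fin_num_measure// nu0.
split; apply: z => A mA.
  by have := congr1 (@complex.Re R) (mu0 A mA).
by have := congr1 (@complex.Im R) (mu0 A mA).
Qed.

End charge_density.

(** * Measures on the two lines *)

Section two_lines_measure.
Context (R : realType).
Local Notation mu := (@lebesgue_measure R).
Implicit Types (f g : R -> R[i]) (Phi : R * R -> R[i]) (Lambda : set (R * R)).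

Let measurable_line (c : R) : measurable_fun setT (fun t : R => (t, c)).
Proof. exact: measurable_fun_pair. Qed.

Let line_measure (c : R) : {measure set (R * R) -> \bar R} :=
  @push_measure _ _ (measurableTypeR R) _ R mu _ (measurable_line c).

(** Arc length as a measure on the plane, a sum of two images of Lebesgue measure; in this form it
    is sigma-finite, as Radon-Nikodym requires. *)
Definition lines_measure : set (R * R) -> \bar R :=
  measure_add (line_measure 0) (line_measure 1).

HB.instance Definition _ := Measure.on lines_measure.

Lemma lines_measureE A :
  lines_measure A = (mu [set t | A (t, 0%R)] + mu [set t | A (t, 1%R)])%E.
Proof. by rewrite /lines_measure measure_addE. Qed.

Let lines_measure_sigma_finite : sigma_finite setT lines_measure.
Proof.
have [F TF mF] := sigma_finiteT mu.
exists (fun i => F i `*` setT).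
  apply/seteqP; split => // x _.
  have [i _ Fi] : (\bigcup_i F i) x.1 by rewrite -TF.
  by exists i.
move=> i; have [mFi Fioo] := mF i; split; first exact: measurableX.
rewrite lines_measureE.
have E c : [set t | (F i `*` setT) (t, c)] = F i.
  by apply/seteqP; split => t //= [].
by rewrite !E lte_add_pinfty.
Qed.

HB.instance Definition _ := @Measure_isSigmaFinite.Build _ _ _
  lines_measure lines_measure_sigma_finite.

Local Notation M := (lines_measure : {sigma_finite_measure set (R * R)%type -> \bar R}).

Lemma arc_length_two_lines A : measurable A ->
  arc_length (two_lines R) A = lines_measure A.
Proof.
move=> mA.
rewrite -[LHS]/(\sum_(j < 2) curve_length (horizontal_line (R := R) j%:R) A)%E.
rewrite (eq_bigr (fun j : 'I_2 => mu [set t | A (t, j%:R)])); last first.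
  by move=> j _; exact: curve_length_line.
by rewrite big_ord_recl big_ord1 lines_measureE.
Qed.

Lemma cL1norm_lines Phi : cmeasurable Phi ->
  cL1norm M Phi =
  (cL1norm mu (fun t => Phi (t, 0%R)) + cL1norm mu (fun t => Phi (t, 1%R)))%E.
Proof.
move=> mP; have mN := measurable_cnorm1E mP.
have P0 z : (0 <= (cnorm1 (Phi z))%:E)%E by rewrite lee_fin cnorm1_ge0.
rewrite /cL1norm /lines_measure ge0_integral_measure_add//.
by congr (_ + _)%E; rewrite /line_measure ge0_integral_push_measure.
Qed.

Let cmeasurable_line Phi (c : R) : cmeasurable Phi ->
  cmeasurable (fun t => Phi (t, c)).
Proof.
move=> [mr mi]; split.
  exact: (measurableT_comp mr (measurable_line c)).
exact: (measurableT_comp mi (measurable_line c)).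
Qed.

Lemma cintegrable_lines Phi : cmeasurable Phi ->
  cintegrable M Phi <->
  cintegrable mu (fun t => Phi (t, 0)) /\ cintegrable mu (fun t => Phi (t, 1)).
Proof.
move=> mP; split=> [/cintegrableP[_]|[/cintegrableP[_ l0] /cintegrableP[_ l1]]].
  rewrite cL1norm_lines// => PM; split; apply/cintegrableP; split;
    try exact: cmeasurable_line.
    by apply: le_lt_trans PM; rewrite leeDl// cL1norm_ge0.
  by apply: le_lt_trans PM; rewrite leeDr// cL1norm_ge0.
by apply/cintegrableP; rewrite cL1norm_lines// lte_add_pinfty.
Qed.

Let line_integral (c : R) (F : R * R -> R) :
  measurable_fun setT (EFin \o F) ->
  mu.-integrable setT (EFin \o (fun t => F (t, c))) ->
  (\int[line_measure c]_x (F x)%:E = \int[mu]_t (F (t, c))%:E)%E /\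
  (line_measure c).-integrable setT (EFin \o F).
Proof.
move=> mF I0; split.
  exact: (@integral_push_measure _ _ (measurableTypeR R) _ R mu _
    (measurable_line c) (EFin \o F) mF I0).
exact: (@integrable_push_measure _ _ (measurableTypeR R) _ R mu _
  (measurable_line c) (EFin \o F) mF I0).
Qed.

Lemma cintegral_lines Phi : cintegrable M Phi ->
  cintegral M Phi =
  cintegral mu (fun t => Phi (t, 0)) + cintegral mu (fun t => Phi (t, 1)).
Proof.
move=> IP; have mP := cintegrable_measurable IP.
have [[r0 i0] [r1 i1]] := (cintegrable_lines mP).1 IP.
have key (F : R * R -> R) : measurable_fun setT F ->
    mu.-integrable setT (EFin \o (fun t => F (t, 0))) ->
    mu.-integrable setT (EFin \o (fun t => F (t, 1))) ->
    \int[M]_x F x = \int[mu]_t F (t, 0) + \int[mu]_t F (t, 1).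
  move=> /measurable_EFinP mF I0 I1.
  rewrite /Rintegral -fineD//; [|exact: integrable_fin_num..].
  congr fine; rewrite /lines_measure integral_measure_add//.
  - by congr (_ + _)%E; [exact: (line_integral mF I0).1|exact: (line_integral mF I1).1].
  - exact: (line_integral mF I0).2.
  - exact: (line_integral mF I1).2.
have [mr mi] := mP; rewrite /cintegral.
by rewrite (key _ mr r0 r1) (key _ mi i0 i1).
Qed.

Lemma fourier_measure_density nu Phi (t s : R) : cm_density M nu Phi ->
  fourier_measure nu (t, s) = fourierL1 (fun x => Phi (x, 0)) t +
    expipi s * fourierL1 (fun x => Phi (x, 1)) t.
Proof.
move=> dP; have IP := cm_density_integrable dP.
have mdot : measurable_fun setT (fun x : R * R => dot2 x (t, s)).
  exact: (measurable_funD (measurable_funM measurable_fst (measurable_cst t))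
    (measurable_funM measurable_snd (measurable_cst s))).
have mE := cmeasurable_expipi mdot.
have EB x : cnorm1 (expipi (dot2 x (t, s))) <= 2 by exact: cnorm1_expipi.
rewrite /fourier_measure (cm_integral_density dP mE EB).
rewrite cintegral_lines; last exact: (cintegrableM mE EB).
have [_ I1] := (cintegrable_lines (cintegrable_measurable IP)).1 IP.
congr (_ + _).
  by apply: eq_cintegral => x; rewrite /dot2 /= mul0r addr0.
rewrite -cintegralZ; last exact: cintegrable_fourier.
by apply: eq_cintegral => x; rewrite /dot2 /= mul1r addrC expipiD mulrA.
Qed.

Lemma lines_density_ex f g : cintegrable mu f -> cintegrable mu g ->
  exists Phi, [/\ cintegrable M Phi, forall t, Phi (t, 0) = f t &
                  forall t, Phi (t, 1) = g t].
Proof.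
move=> If Ig.
(* Linear interpolation in the second coordinate is visibly measurable; only the values at heights 0
   and 1 matter. *)
pose Phi (x : R * R) := (1 - x.2)%:C * f x.1 + (x.2)%:C * g x.1.
have P0 t : Phi (t, 0) = f t by rewrite /Phi /= subr0 mul1r mul0r addr0.
have P1 t : Phi (t, 1) = g t by rewrite /Phi /= subrr mul1r mul0r add0r.
have mfst h : cmeasurable h -> cmeasurable (fun x : R * R => h x.1).
  move=> [mr mi]; split; [exact: (measurableT_comp mr measurable_fst)|
    exact: (measurableT_comp mi measurable_fst)].
have mP : cmeasurable Phi.
  apply: cmeasurableD; apply: cmeasurableM.
  - apply: cmeasurable_real; apply: measurable_funB => //; exact: measurable_snd.
  - exact: mfst (cintegrable_measurable If).
  - apply: cmeasurable_real; exact: measurable_snd.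
  - exact: mfst (cintegrable_measurable Ig).
exists Phi; split; [|exact: P0|exact: P1].
apply/(cintegrable_lines mP); split.
  by rewrite (funext P0 : (fun t => Phi (t, 0)) = f).
by rewrite (funext P1 : (fun t => Phi (t, 1)) = g).
Qed.

(** The complement of the lines is open, and each of its measurable subsets is null for
    [lines_measure], hence for [nu]. *)
Lemma cm_support_lines nu Phi : cm_density M nu Phi ->
  cm_support nu `<=` [set: R] `*` [set 0; 1].
Proof.
move=> dP x xS; apply: contrapT => xG.
pose U : set (R * R) := ~` ([set: R] `*` [set 0; 1]).
have oU : open U.
  have -> : U = snd @^-1` (~` [set 0; 1]).
    apply/seteqP; split => z /= h; first by move=> z01; apply: h.
    by move=> [_ /h].
  apply: open_comp; first by move=> z _; exact: cvg_snd.
  apply: closed_openC; apply: closedU; exact: closed_eq.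
have [A [mA AU /eqP]] := xS U oU xG; apply.
apply: (cm_eval_density_null dP mA); rewrite [LHS]lines_measureE.
have E c : [set 0; 1] c -> [set t | A (t, c)] = set0.
  by move=> c01; apply/seteqP; split => t //= /AU; apply; split.
by rewrite !E ?measure0 ?adde0//; [right|left].
Qed.

End two_lines_measure.

(** * The kernel of the exponential *)

Section expipi_eq.
Context (R : realType).

(** Removing an even integer leaves [y] in [[0, 2[] with [cos (pi y) = 1]. Injectivity of the cosine
    on [[0, pi]] settles [y <= 1]; for larger [y] it is applied to [2 pi - pi y] and contradicts
    [y < 2]. *)
Lemma expipi_eq1 (x : R) : expipi x = 1 -> even_integers x.
Proof.
move=> ex; have pi0 := pi_gt0 R.
pose k := Num.floor (x / 2).
exists k => //; pose y := x - 2 * k%:~R.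
have [y0 y2] : 0 <= y /\ y < 2.
  have := floor_le (x / 2); have := floorD1_gt (x / 2).
  by rewrite -/k intrD /y => ? ?; split; lra.
have cy : cos (pi * y) = 1.
  have : expipi y = 1 by rewrite -ex -(expipi_periodic y k) /y subrK.
  by move/(congr1 (@complex.Re R)).
suff : y = 0 by rewrite /y; lra.
have cinj (z : R) : 0 <= z <= pi -> cos z = 1 -> z = 0.
  move=> zpi cz; apply: cos_inj; [by rewrite in_itv| |by rewrite cz cos0].
  by rewrite in_itv /= lexx ltW.
have [y1|y1] := leP y 1.
  have : pi * y = 0 by apply: cinj => //; apply/andP; split; nra.
  by move/eqP; rewrite mulf_eq0 gt_eqF//= => /eqP.
have : pi *+ 2 - pi * y = 0.
  apply: cinj; first by rewrite mulr2n; apply/andP; split; nra.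
  by rewrite addrC cosD2pi cosN.
by rewrite mulr2n => h; nra.
Qed.

Lemma expipi_inj (x y : R) : expipi x = expipi y -> even_integers (x - y).
Proof. by move=> xy; apply: expipi_eq1; rewrite expipiD xy expipiNK. Qed.

End expipi_eq.

(** * Transforms that vanish on Lambda *)

Section heisenberg.
Context (R : realType).
Local Notation mu := (@lebesgue_measure R).
Local Notation M :=
  (@lines_measure R : {sigma_finite_measure set (R * R)%type -> \bar R}).
Variable Lambda : set (R * R).
Local Notation D := (pi1a Lambda `|` (pi1b Lambda `\` pi1c Lambda)).

Lemma fourier_vanishing_exceptional f g : cintegrable mu f -> cintegrable mu g ->
  (forall t s, Lambda (t, s) -> fourierL1 f t + expipi s * fourierL1 g t = 0) ->
  forall t, D t -> fourierL1 f t = 0 /\ fourierL1 g t = 0.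
Proof.
move=> If Ig H t.
suff g0 : D t -> fourierL1 g t = 0.
  move=> Dt; have gt := g0 Dt; split => //.
  have [s ts] : exists s, Lambda (t, s).
    case: Dt => [[s [_ [ts _ _]]]|[[[[t' s] ts /= tt'] _] _]]; first by exists s.
    by exists s; rewrite -tt'.
  by have := H _ _ ts; rewrite gt mulr0 addr0.
case=> [[s [s' [ts ts' ss']]]|[tb tc]].
  have /addrI/eqP := etrans (H _ _ ts) (esym (H _ _ ts')).
  rewrite -subr_eq0 -mulrBl mulf_eq0 => /orP[|/eqP//].
  by rewrite subr_eq0 => /eqP /expipi_inj.
have [//|g0] := eqVneq (fourierL1 g t) 0; exfalso; apply: tc; split => //.
have Im : cintegrable mu (fun x => (-1) * f x) by exact: cintegrableZ.
have [l [h [l0 Ih Fh]]] := wiener_division Im Ig g0.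
have [l' l'0 gn0] := fourierL1_neq0_near Ig g0.
pose r := Num.min l l'.
have r0 : 0 < r by rewrite lt_min l0 l'0.
exists (ball t r), h; split => //.
- exact: ball_open.
- by rewrite ball_itv; exact: interval_is_interval.
- exact: ballxx.
move=> u [ub]; rewrite /= -ball_normE /= distrC => ut.
have [ul ul'] : `|u - t| <= l /\ `|u - t| <= l'.
  by move: ut; rewrite /r lt_min => /andP[/ltW ? /ltW ?].
have [[[u' s] us /= u'u] ua] := ub; rewrite u'u in us.
(* At [u] both [g^ h^] and [chi g^] equal [- f^]. Cancelling [g^(u)] is possible because the radius
   [r] also keeps [g^] nonzero on the whole ball. *)
rewrite (chiE ub us); apply: (mulfI (gn0 u ul')).
rewrite Fh// fourierL1Z// mulN1r [RHS]mulrC.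
by apply/eqP; rewrite eqr_oppLR -addr_eq0 H.
Qed.

(** The set where [g^] is nonzero contains a ball around each of its points, so it would meet a
    dense set. *)
Lemma fourier_vanishing_dense g : dense D -> cintegrable mu g ->
  (forall t, D t -> fourierL1 g t = 0) -> forall t, fourierL1 g t = 0.
Proof.
move=> dD Ig g0 t; have [//|gt] := eqVneq (fourierL1 g t) 0; exfalso.
have [l l0 gn0] := fourierL1_neq0_near Ig gt.
have [||u [ut Du]] := dD (ball t l).
- by exists t; exact: ballxx.
- exact: ball_open.
have /gn0 : `|u - t| <= l by move: ut; rewrite -ball_normE /= distrC => /ltW.
by rewrite g0// eqxx.
Qed.

(** A point of the projection inside [O] must lie in [pi1c], which supplies [h] around it. If [O]
    contains no such point, the condition on [h] is vacuous near any centre in [O], and [h = 0]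
    serves. *)
Lemma locally_fourier_of_not_dense (O : set R) : O !=set0 -> open O ->
  O `&` D = set0 ->
  exists (t0 r : R) h, [/\ 0 < r, cintegrable mu h &
    forall t s, `|t - t0| < r -> Lambda (t, s) -> fourierL1 h t = expipi s].
Proof.
move=> [t1 Ot1] oO OD.
have inb t s : O t -> Lambda (t, s) -> pi1b Lambda t.
  move=> Ot ts; split; first by exists (t, s).
  move=> ta; suff : (O `&` D) t by rewrite OD.
  by split => //; left.
have ballP (J : set R) (t : R) : open J -> J t ->
    exists2 r : R, 0 < r & forall u, `|u - t| < r -> J u.
  move=> oJ Jt; have /nbhs_ballP[r /= r0 rJ] : nbhs t J by exact: open_nbhs_nbhs.
  exists r => // u ut; apply: rJ; by rewrite -ball_normE /= distrC.
have [[t0 [s0 [Ot0 ts0]]]|nL] := pselect (exists t0 s0, O t0 /\ Lambda (t0, s0)).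
  have tc : pi1c Lambda t0.
    apply: contrapT => ntc; suff : (O `&` D) t0 by rewrite OD.
    by split => //; right; split => //; exact: inb ts0.
  have [_ [I [h [oI _ It0 Ih hE]]]] := tc.
  have [r r0 rJ] := ballP _ _ (openI oO oI) (conj Ot0 It0).
  exists t0, r, h; split => // t s /rJ[Ot It] ts.
  have tb := inb _ _ Ot ts.
  by rewrite hE// (chiE tb ts).
have [r r0 rO] := ballP _ _ oO Ot1.
exists t1, r, (cst 0); split => //; first exact: cintegrable0.
by move=> t s /rO Ot ts; exfalso; apply: nL; exists t, s.
Qed.

End heisenberg.

Theorem theorem1p1 (R : realType) (Lambda : set (R * R)) :
  @heisenberg_uniqueness_pair R ([set: R] `*` [set 0; 1]) (two_lines R) Lambda
  <-> dense (pi1a Lambda `|` (pi1b Lambda `\` pi1c Lambda)).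
Proof.
split=> [hup|dD nu _ nuac nuL A mA].
  apply: contrapT => /denseNE[W [[x [oW Wx]] WD]].
  have [t0 [r [h [r0 Ih hE]]]] :=
    locally_fourier_of_not_dense (ex_intro _ x Wx) oW WD.
  (* Its transform is a trapezoid centred at [t0], equal to 1 at [t0] and zero from distance [r] on,
     that is, wherever [h] is not controlled. *)
  pose g x := expipi (x * - t0) * (trapker (r / 2) r x)%:C.
  have Ig : cintegrable lebesgue_measure g.
    exact: cintegrable_fourier (cintegrable_trapker _ _).
  have rr : r / 2 < r by lra.
  have Fg t : fourierL1 g t = (trapezoid (r / 2) r (t - t0))%:C.
    by rewrite /g fourierL1_modulation fourierL1_trapker.
  have [f [If Ff _]] := convolution_exists (cintegrableZ (-1) Ih) Ig.
  have [Phi [IP P0 P1]] := lines_density_ex If Ig.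
  have P0' : (fun x => Phi (x, 0)) = f by apply/funext.
  have P1' : (fun x => Phi (x, 1)) = g by apply/funext.
  have [nu dP] := density_cm_ex IP.
  have nu0 : forall A, measurable A -> cm_eval nu A = 0.
    apply: hup.
    - exact: cm_support_lines dP.
    - move=> A mA; rewrite arc_length_two_lines//.
      exact: cm_eval_density_null dP mA.
    - move=> [t s] ts; rewrite (fourier_measure_density _ _ dP) P0' P1' Ff.
      rewrite fourierL1Z// mulN1r Fg.
      have [tr|tr] := leP r `|t - t0|.
        by rewrite trapezoid0 ?mulr0 ?addr0//; lra.
      by rewrite (hE t s)// mulNr addNr.
  (* The same transform is computed twice, from the density 0 and from [Phi]. The heights 0 and 1
     over [t0] carry the factors 1 and -1, which gives incompatible values for the transform of [f]
     at [t0]. *)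
  have d0 : cm_density (@lines_measure R) nu (cst 0) by exact: cm_density_cst0.
  have F0 s : fourier_measure nu (t0, s) = 0.
    by rewrite (fourier_measure_density _ _ d0) !fourierL1_cst0 mulr0 addr0.
  have gt0 : fourierL1 g t0 = 1.
    by rewrite Fg subrr trapezoid1// normr0; lra.
  have e1 : expipi (1 : R) = -1.
    by rewrite /expipi mulr1 cospi sinpi; apply/eqP; rewrite eq_complex /= oppr0 !eqxx.
  have := F0 0; have := F0 1.
  rewrite !(fourier_measure_density _ _ dP) P0' P1' gt0 e1 expipi0 !mulr1.
  move=> /eqP; rewrite subr_eq0 => /eqP -> /eqP.
  by rewrite -mulr2n pnatr_eq0.
have [Phi dP] : exists Phi, cm_density (@lines_measure R) nu Phi.
  apply: cm_density_ex => B mB MB; apply: nuac => //.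
  by rewrite arc_length_two_lines.
have IP := cm_density_integrable dP; have mP := cintegrable_measurable IP.
have [If Ig] := (cintegrable_lines mP).1 IP.
have fg := fourier_vanishing_exceptional If Ig
  (fun t s ts => etrans (esym (fourier_measure_density t s dP)) (nuL _ ts)).
have f0 := fourierL1_eq0 If
  (fourier_vanishing_dense dD If (fun t Dt => (fg t Dt).1)).
have g0 := fourierL1_eq0 Ig
  (fourier_vanishing_dense dD Ig (fun t Dt => (fg t Dt).2)).
have zero (k : R -> R[i]) : cintegrable lebesgue_measure k ->
    {ae lebesgue_measure, forall x, k x = 0} -> cL1norm lebesgue_measure k = 0%E.
  move=> Ik k0; rewrite /cL1norm -(integral0 lebesgue_measure setT).
  apply: ae_eq_integral => //.
    exact: measurable_cnorm1E (cintegrable_measurable Ik).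
  move: k0; apply: (filterS (Filter := ae_filter_ringOfSetsType lebesgue_measure)).
  by move=> x -> _; rewrite cnorm1_0.
apply: (cm_eval_density_eq0 dP mA).
by rewrite cL1norm_lines// !zero// adde0.
Qed.
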